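(* Let $\mathcal{S}$ and $\mathcal{T}$ be function systems. Then $\mathcal{S}$ and $\mathcal{T}$ are $\Delta$-equivalent if and only if $\overline{\mathcal{S}}\simeq\overline{\mathcal{T}}$ up to (unital) complete order isomorphism.
   Context: An operator system is a (not necessarily closed) selfadjoint subspace of some $\mathcal{B}(H)$ containing $I_H$. A function system is an operator subsystem of $\mathrm{C}(X)$, for a compact Hausdorff space $X$, that separates the points of $X$. An overline denotes norm closure. $[\,\cdot\,]$ is norm-closed linear span. A TRO is a linear subspace $\mathcal{M}\subseteq\mathcal{B}(H,K)$ with $\mathcal{M}\mathcal{M}^*\mathcal{M}\subseteq\mathcal{M}$; it is non-degenerate if $I_H\in[\mathcal{M}^*\mathcal{M}]$ and $I_K\in[\mathcal{M}\mathcal{M}^*]$. Concrete operator systems $\mathcal{S}\subseteq\mathcal{B}(H)$, $\mathcal{T}\subseteq\mathcal{B}(K)$ are TRO-equivalent if there is a non-degenerate TRO $\mathcal{M}\subseteq\mathcal{B}(H,K)$ with $\mathcal{M}^*\mathcal{T}\mathcal{M}\subseteq\overline{\mathcal{S}}$ and $\mathcal{M}\mathcal{S}\mathcal{M}^*\subseteq\overline{\mathcal{T}}$. Operator systems are $\Delta$-equivalent if they have unital complete order embeddings with TRO-equivalent images. *)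

(* Defs.v *)
From HB Require Import structures.
From mathcomp Require Import all_boot all_order all_algebra.
From mathcomp Require Import complex.
From mathcomp Require Import all_classical all_reals all_analysis.

Set Implicit Arguments.
Unset Strict Implicit.
Unset Printing Implicit Defensive.

Import Order.TTheory GRing.Theory Num.Theory.
Import numFieldNormedType.Exports.

Local Open Scope classical_set_scope.
Local Open Scope ring_scope.

(* Scalars are R[i]; on R[i], 0 <= z means that z is real and nonnegative, so
   that a bound 0 < e ranges over the positive reals.  The topology of the
   complex plane is carried by R[i]^o.  Operators and functions are plain
   functions; the spaces B(H, K) and C(X) are sets of functions inside the
   left modules H -> K and X -> R[i]^o. *)

Section LinearSets.
Context {R : realType} {V : lmodType R[i]}.

Definition linear_subspace (S : set V) : Prop :=
  S 0 /\ (forall (a : R[i]) (u v : V), S u -> S v -> S (a *: u + v)).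

Definition linear_span (E : set V) : set V := smallest linear_subspace E.

End LinearSets.

(* Inner products are linear in the first variable. *)
Record hilbertSpace (R : realType) := HilbertSpace {
  hcarrier :> completeNormedModType R[i];
  hdot : {dot hcarrier for Num.conj};
  hnormE : forall x : hcarrier, `|x| ^+ 2 = hdot x x }.

Arguments hdot {R h}.

Section Operators.
Context {R : realType}.
Implicit Types H K L : hilbertSpace R.

(* For linear A and c >= 0, this says that the operator norm is at most c. *)
Definition op_norm_le {H K} (A : H -> K) (c : R[i]) : Prop :=
  forall x : H, `|A x| <= c * `|x|.

Definition bounded_operator H K : set (H -> K) :=
  [set A | linear A /\ exists c : R[i], op_norm_le A c].

Arguments bounded_operator : clear implicits.

Definition op_closure {H K} (S : set (H -> K)) : set (H -> K) :=
  [set A | bounded_operator H K A /\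
    forall e : R[i], 0 < e -> exists2 B, S B & op_norm_le (A - B) e].

Definition is_adjoint {H K} (A : H -> K) (B : K -> H) : Prop :=
  forall (x : H) (y : K), hdot (A x) y = hdot x (B y).

Definition adjoint_set {H K} (M : set (H -> K)) : set (K -> H) :=
  [set B | exists2 A, M A & is_adjoint A B].

(* The set of products, not its span. *)
Definition product_set {H K L} (M : set (K -> L)) (N : set (H -> K)) :
    set (H -> L) :=
  [set C | exists A B, [/\ M A, N B & C = A \o B]].

Definition closed_span {H K} (E : set (H -> K)) : set (H -> K) :=
  op_closure (linear_span E).

Definition concrete_operator_system {H} (S : set (H -> H)) : Prop :=
  [/\ S `<=` bounded_operator H H, linear_subspace S,
      adjoint_set S `<=` S & S idfun].

Definition TRO {H K} (M : set (H -> K)) : Prop :=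
  [/\ M `<=` bounded_operator H K, linear_subspace M &
      product_set (product_set M (adjoint_set M)) M `<=` M].

Definition nondegenerate {H K} (M : set (H -> K)) : Prop :=
  closed_span (product_set (adjoint_set M) M) idfun /\
  closed_span (product_set M (adjoint_set M)) idfun.

Definition TRO_equivalent {H K} (S : set (H -> H)) (T : set (K -> K)) : Prop :=
  [/\ concrete_operator_system S, concrete_operator_system T &
  exists M : set (H -> K),
    [/\ TRO M, nondegenerate M,
        product_set (product_set (adjoint_set M) T) M `<=` op_closure S &
        product_set (product_set M S) (adjoint_set M) `<=` op_closure T]].

End Operators.

Arguments bounded_operator {R} H K.

(* A module with a unit and, for every n, a positive cone of n x n matrices:
   the data that complete order embeddings see. *)
Record matrixOrderedSpace (R : realType) := MatrixOrderedSpace {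
  mos_carrier :> lmodType R[i];
  mos_unit : mos_carrier;
  mos_pos : forall n : nat, set 'M[mos_carrier]_n }.

Arguments mos_unit {R}.
Arguments mos_pos {R} _ {n}.

Section Ambient.
Context {R : realType}.

(* T in M_n(B(H)) is positive when it is so as an operator on H^n. *)
Definition op_pos (H : hilbertSpace R) (n : nat) : set 'M[H -> H]_n :=
  [set T | forall h : 'I_n -> H,
    0 <= \sum_(i < n) \sum_(j < n) hdot (T i j (h j)) (h i)].

(* M_n(C(X)) = C(X, M_n): F is positive when the scalar matrix F(x) is
   positive semidefinite for every x. *)
Definition fun_pos (X : topologicalType) (n : nat) : set 'M[X -> R[i]^o]_n :=
  [set F | forall (x : X) (v : 'I_n -> R[i]),
    0 <= \sum_(i < n) \sum_(j < n) F i j x * v j * (v i)^*].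

Definition Bop (H : hilbertSpace R) : matrixOrderedSpace R :=
  MatrixOrderedSpace (idfun : H -> H) (@op_pos H).

Definition Cfun (X : topologicalType) : matrixOrderedSpace R :=
  MatrixOrderedSpace (cst 1 : X -> R[i]^o) (@fun_pos X).

End Ambient.

Arguments Cfun R X : clear implicits.

Section Morphisms.
Context {R : realType}.
Implicit Types V W : matrixOrderedSpace R.

(* phi is only constrained on S, which is meant to be an operator system. *)
Definition unital_complete_order_embedding {V W} (S : set V) (T : set W)
    (phi : V -> W) : Prop :=
  [/\ forall u, S u -> T (phi u),
      forall (a : R[i]) (u v : V), S u -> S v ->
        phi (a *: u + v) = a *: phi u + phi v,
      phi (mos_unit V) = mos_unit W,
      forall u v, S u -> S v -> phi u = phi v -> u = v &
      forall (n : nat) (A : 'M[V]_n), (forall i j, S (A i j)) ->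
        mos_pos V A <-> mos_pos W (map_mx phi A)].

Definition unital_complete_order_isomorphic {V W} (S : set V) (T : set W) :
    Prop :=
  exists2 phi : V -> W,
    unital_complete_order_embedding S T phi & phi @` S = T.

Definition Delta_equivalent {V W} (S : set V) (T : set W) : Prop :=
  exists (H K : hilbertSpace R) (phi : V -> Bop H) (psi : W -> Bop K),
    [/\ unital_complete_order_embedding S
          (bounded_operator H H : set (Bop H)) phi,
        unital_complete_order_embedding T
          (bounded_operator K K : set (Bop K)) psi &
        TRO_equivalent (H := H) (K := K) (phi @` S) (psi @` T)].

End Morphisms.

Section FunctionSystems.
Context {R : realType} {X : topologicalType}.

Definition function_system (S : set (Cfun R X)) : Prop :=
  [/\ forall f, S f -> continuous f,
      linear_subspace S,
      forall f, S f -> S (fun x => (f x)^*),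
      S (cst 1) &
      forall x y : X, x <> y -> exists2 f, S f & f x <> f y].

(* Closure in C(X) for the supremum norm. *)
Definition sup_closure (S : set (Cfun R X)) : set (Cfun R X) :=
  [set f | continuous f /\
    forall e : R[i], 0 < e ->
      exists2 g, S g & forall x : X, `|f x - g x| <= e].

End FunctionSystems.

(* Main.v *)
(* The 2 x 2 matrix with entries c, u, u^*, c is positive exactly when
   |u| <= c, so unital complete order embeddings are isometric, preserve
   adjoints, and extend to closures.

   If the closures are isomorphic via theta, let C(Y) act on l^2(Y) by
   multiplication.  The images of T and of S (through theta) have the same norm
   closure there, and the scalar operators are a TRO equivalence.

   Conversely let M be a TRO equivalence of S' = closure of phi(S) and
   T' = closure of psi(T).  As S' is a function system, a 2 x 2 matrix over S'
   is positive as soon as all its compressions to scalar vectors are, a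
   criterion stable under transposition.  Transposing (1, a)^* s (1, a) for
   a = m^* m gives a positive matrix whose form at (- a h, h) is forced to
   degenerate, whence a s = s a: the algebra generated by M^* M commutes with
   S'.  Hence, for u = sum of m_i n_i^* close to 1, t = sum of m_i s n_i^*
   satisfies t m = u m s, and these t converge in T' to an operator t with
   t m = m s and m^* t = s m^* for all m in M.  From t^j m = m s^j and
   log-convexity of |t^j z| the correspondence s <-> t is isometric on
   selfadjoint elements; it is unital, hence positive, and an order
   isomorphism between function systems is a complete one. *)
Require Import Defs.
From HB Require Import structures.
From mathcomp Require Import all_boot all_order all_algebra.
From mathcomp Require Import complex finmap ring.
From mathcomp Require Import all_classical all_reals all_analysis.

Set Implicit Arguments.
Unset Strict Implicit.
Unset Printing Implicit Defensive.

Import Order.TTheory GRing.Theory Num.Theory.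
Import numFieldNormedType.Exports.

Local Open Scope classical_set_scope.
Local Open Scope ring_scope.

(** * Inner products *)

(** The image of a function system under a complete order embedding may generate a noncommutative
    C*-algebra, so nothing commutes for free; what survives is that transposing a matrix over it
    keeps positivity. For a scalar, the transposed form vanishes at (- a h, h) together with its
    first variation in the first entry; comparing c + s with c - s therefore leaves only the first
    variation of s, which is the commutator of a and s, and forces it to be zero. The second
    obstacle is that a sum of m_i s n_i^* has no evident bound in terms of u, the sum of m_i n_i^*,
    because the number of terms is not controlled. Two such pairs satisfy t' u = u' t; fixing one u
    within 1/2 of 1 bounds every other t by a multiple of the norm of its u. Embeddings are extended
    to closures as closed graphs, not as maps, so that functions and operators play symmetric
    roles. *)

Section CauchySchwarz.
Context {R : realType} {V : lmodType R[i]} {d : V -> V -> R[i]}.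
Hypothesis d_linear : forall a x y z, d (a *: x + y) z = a * d x z + d y z.
Hypothesis d_herm : forall x y, d x y = (d y x)^*.
Hypothesis d_ge0 : forall x, 0 <= d x x.
Hypothesis d_eq0 : forall x, d x x = 0 -> x = 0.

Let d_linear_r a x y z : d z (a *: x + y) = a^* * d z x + d z y.
Proof. by rewrite d_herm d_linear rmorphD rmorphM/= -!d_herm. Qed.

Let d0 x : d x 0 = 0.
Proof. by have := d_linear_r (-1) 0 0 x; rewrite scaleN1r addNr rmorphN rmorph1 mulN1r addNr. Qed.

(* For x <> 0, expand 0 <= |y - (<y, x> / |x|^2) x|^2. *)
Lemma form_cauchy_schwarz x y : `|d y x| ^+ 2 <= d y y * d x x.
Proof.
have [->|x0] := eqVneq x 0; first by rewrite !d0 normr0 expr0n mulr0.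
have x2 : 0 < d x x.
  by rewrite lt_neqAle d_ge0 andbT eq_sym; apply: contra_neq x0 => /d_eq0.
rewrite -ler_pdivrMr// -subr_ge0 normCK.
set e := d y x.
have := d_ge0 (- (e / d x x) *: x + y).
rewrite d_linear !d_linear_r (d_herm x y) -/e rmorphN rmorphM fmorphV/=.
rewrite (geC0_conj (ltW x2)).
by have xn := gt_eqF x2; congr (0 <= _); field; rewrite xn.
Qed.

Lemma form_minkowski x y : sqrtC (d (x + y) (x + y)) <= sqrtC (d x x) + sqrtC (d y y).
Proof.
have r0 z : 0 <= sqrtC (d z z) by rewrite sqrtC_ge0.
rewrite -(@ler_pXn2r _ 2)// ?nnegrE ?addr_ge0// sqrrD !sqrtCK.
have dDr z : d z (x + y) = d z x + d z y.
  by have := d_linear_r 1 x y z; rewrite scale1r rmorph1 mul1r.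
have dDl z : d (x + y) z = d x z + d y z.
  by have := d_linear 1 x y z; rewrite scale1r mul1r.
rewrite dDl !dDr (d_herm x y).
rewrite [leLHS](_ : _ = d x x + d y y + (d y x + (d y x)^*)); last by ring.
rewrite [leRHS]addrAC lerD2l.
have h : `|d y x| <= sqrtC (d x x) * sqrtC (d y y).
  rewrite -(@ler_pXn2r _ 2)// ?nnegrE ?mulr_ge0// exprMn !sqrtCK mulrC.
  exact: form_cauchy_schwarz.
have r : d y x + (d y x)^* \is Num.real.
  by apply/CrealP; rewrite rmorphD/= conjCK addrC.
rewrite (le_trans (real_ler_norm r))// (le_trans (ler_normD _ _))// norm_conjC.
by rewrite -mulr2n lerMn2r h.
Qed.

End CauchySchwarz.

Section Dot.
Context {R : realType} {H : hilbertSpace R}.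
Implicit Types x y z : H.

Lemma dotDl x y z : hdot (x + y) z = hdot x z + hdot y z.
Proof. exact: linearDl. Qed.

Lemma dotDr x y z : hdot x (y + z) = hdot x y + hdot x z.
Proof. by rewrite raddfD. Qed.

Lemma dotZl (a : R[i]) x y : hdot (a *: x) y = a * hdot x y.
Proof. exact: linearZl_LR. Qed.

Lemma dotZr (a : R[i]) x y : hdot x (a *: y) = a^* * hdot x y.
Proof. exact: linearZr_LR. Qed.

Lemma dotC x y : hdot x y = (hdot y x)^*.
Proof. by rewrite hermC/= mul1r. Qed.

Lemma dotNl x y : hdot (- x) y = - hdot x y.
Proof. by rewrite -scaleN1r dotZl mulN1r. Qed.

Lemma dotNr x y : hdot x (- y) = - hdot x y.
Proof. exact: raddfN. Qed.

Lemma dotBl x y z : hdot (x - y) z = hdot x z - hdot y z.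
Proof. by rewrite dotDl dotNl. Qed.

Lemma dotBr x y z : hdot x (y - z) = hdot x y - hdot x z.
Proof. by rewrite dotDr dotNr. Qed.

Lemma dotxx_ge0 x : 0 <= hdot x x.
Proof. by rewrite -hnormE exprn_ge0. Qed.

Lemma dot_inj x : (forall y, hdot x y = 0) -> x = 0.
Proof.
by move=> /(_ x)/eqP; rewrite -hnormE expf_eq0/= normr_eq0 => /eqP.
Qed.

Lemma dot_inj2 x x' : (forall y, hdot x y = hdot x' y) -> x = x'.
Proof.
by move=> h; apply/subr0_eq/dot_inj => y; rewrite dotBl h subrr.
Qed.

Lemma dot_norm_le x y : `|hdot y x| <= `|y| * `|x|.
Proof.
rewrite -(@ler_pXn2r _ 2)// ?nnegrE ?mulr_ge0// exprMn !hnormE.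
apply: form_cauchy_schwarz => [a u v w|u v|u|u u0]; first by rewrite dotDl dotZl.
- exact: dotC.
- exact: dotxx_ge0.
by apply/eqP; rewrite -normr_eq0 -sqrf_eq0 hnormE u0.
Qed.

End Dot.

Section Linear.
Context {R : realType} {U V : lmodType R[i]} (A : U -> V) (HA : linear A).

Lemma linD x y : A (x + y) = A x + A y.
Proof. by have := HA 1 x y; rewrite !scale1r. Qed.

Lemma lin0 : A 0 = 0.
Proof. by apply: (@addrI _ (A 0)); rewrite -linD !addr0. Qed.

Lemma linZ a x : A (a *: x) = a *: A x.
Proof. by have := HA a x 0; rewrite lin0 !addr0. Qed.

Lemma linN x : A (- x) = - A x.
Proof. by rewrite -[- x]scaleN1r linZ scaleN1r. Qed.

Lemma linB x y : A (x - y) = A x - A y.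
Proof. by rewrite linD linN. Qed.

End Linear.

(** * Complex scalars *)

Section Scalars.
Context {R : realType}.
Implicit Types (z w : R[i]).

Definition invS (k : nat) : R[i] := k.+1%:R^-1.

Lemma invS_gt0 k : 0 < invS k.
Proof. by rewrite invr_gt0 ltr0n. Qed.

Lemma invS_small (e : R[i]) : 0 < e -> exists k, invS k < e.
Proof.
move=> e0; have eR : (complex.Re e)%:C%C = e by rewrite RRe_real// gtr0_real.
have r0 : 0 < complex.Re e by rewrite -ltcR eR.
have [k hk] : exists k : nat, (complex.Re e)^-1 < k%:R.
  by exists (Num.bound (complex.Re e)^-1); rewrite archi_boundP// invr_ge0 ltW.
exists k; rewrite /invS invf_plt ?posrE// -eR -fmorphV /=.
rewrite (_ : k.+1%:R = k.+1%:R%:C%C); last by rewrite rmorph_nat.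
by rewrite ltcR (lt_trans hk)// ltr_nat.
Qed.

(** The fixed factor [c] lets an approximation argument keep whatever constant it produces, instead
    of tuning the tolerance beforehand. *)
Lemma le_eps (a b c : R[i]) : 0 <= c ->
  (forall e, 0 < e -> a <= b + e * c) -> a <= b.
Proof.
move=> c0 h; apply/ler_addgt0Pr => e e0.
have c1 : 0 < c + 1 by rewrite ltr_wpDl.
apply: (le_trans (h (e / (c + 1)) _)); first exact: divr_gt0.
by rewrite lerD2l -mulrA ler_piMr ?(ltW e0)// mulrC ler_pdivrMr// mul1r lerDl.
Qed.

Lemma small_slope (a b : R[i]) : 0 <= a ->
  (forall t, 0 < t -> t * b <= t ^+ 2 * a) -> b <= 0.
Proof.
move=> a0 h; apply: (@le_eps _ _ a) => // e e0.
by rewrite add0r -(ler_pM2l e0) mulrA -expr2 h.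
Qed.

(** Nonnegativity includes being real, so the imaginary part has to vanish first: [z^* - z] only
    sees the error [z - w]. *)
Lemma ge0_closed z (c : R[i]) : 0 <= c ->
  (forall e, 0 < e -> exists2 w, 0 <= w & `|z - w| <= e * c) -> 0 <= z.
Proof.
move=> c0 h.
have zre : z \is Num.real.
  apply/CrealP/eqP; rewrite -subr_eq0 -normr_le0.
  apply: (@le_eps _ _ (c + c)); first exact: addr_ge0.
  move=> e /h[w w0 zw]; rewrite add0r.
  have -> : z^* - z = (z - w)^* - (z - w).
    by rewrite rmorphB/= (geC0_conj w0); ring.
  by rewrite (le_trans (ler_normB _ _))// norm_conjC mulrDr lerD.
rewrite -oppr_le0; apply: (@le_eps _ _ c) => // e /h[w w0 zw].
rewrite add0r (le_trans _ zw)//.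
have -> : - z = (w - z) - w by ring.
have wr : w - z \is Num.real by rewrite rpredB// ger0_real.
rewrite distrC (le_trans _ (real_ler_norm wr))//.
by rewrite gerBl.
Qed.

Lemma ge_norm_addC z : - (z + z^*) <= 2 * `|z|.
Proof.
rewrite mulr_natl mulr2n -[X in _ <= _ + X]norm_conjC.
have r : - (z + z^*) \is Num.real.
  by rewrite rpredN; apply/CrealP; rewrite rmorphD/= conjCK addrC.
by rewrite (le_trans (real_ler_norm r))// normrN ler_normD.
Qed.

Lemma cauchy_limit (V : completeNormedModType R[i]) (x : nat -> V) (c : R[i]) :
  0 <= c -> (forall k l, `|x k - x l| <= c * (invS k + invS l)) ->
  exists y, forall k, `|x k - y| <= c * invS k.
Proof.
move=> c0 hx.
have inv_eps e : 0 < e -> exists N, forall l, (N <= l)%N -> c * invS l < e.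
  move=> e0; have c1 : 0 < c + 1 by rewrite ltr_wpDl.
  have [N hN] := invS_small (divr_gt0 e0 c1).
  exists N => l Nl; rewrite ltr_pdivlMr// in hN.
  apply: le_lt_trans hN; rewrite mulrC ler_pM ?(ltW (invS_gt0 _))//.
    by rewrite lef_pV2 ?posrE ?ltr0n// ler_nat ltnS.
  by rewrite lerDl.
have : cvg (x @ \oo).
  apply/cauchy_cvgP; apply: cauchy_exP => e e0.
  have [N hN] := inv_eps (e / 2) (divr_gt0 e0 (ltr0Sn _ 1)).
  exists (x N); exists N => // l /= Nl; rewrite -ball_normE/=.
  by rewrite (le_lt_trans (hx _ _))// mulrDr [ltRHS]splitr ltrD// hN.
move=> /cvg_ex[y xy]; exists y => k.
apply/ler_addgt0Pr => e e0.
have /cvgrPdist_lt/(_ _ (divr_gt0 e0 (ltr0Sn _ 1))) [N1 _ hN1] := xy.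
have [N2 hN2] := inv_eps (e / 2) (divr_gt0 e0 (ltr0Sn _ 1)).
pose l := maxn N1 N2.
have := hN1 l (leq_maxl _ _); have := hN2 l (leq_maxr _ _) => /= h2 h1.
have -> : x k - y = (x k - x l) + (x l - y) by rewrite addrA subrK.
rewrite (le_trans (ler_normD _ _))// [X in _ <= _ + X]splitr addrA lerD//.
  by rewrite (le_trans (hx _ _))// mulrDr lerD2l ltW.
by rewrite distrC ltW.
Qed.

(** Balls of radius [invS k] that belong to the Cauchy filter have centres at distance at most
    [invS k + invS l], so sequences with this rate settle completeness. *)
Lemma seq_complete (V : normedModType R[i]) :
  (forall x : nat -> V, (forall k l, `|x k - x l| <= invS k + invS l) ->
     exists y, forall k, `|x k - y| <= invS k) ->
  forall F : set_system V, ProperFilter F -> cauchy F -> cvg F.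
Proof.
move=> hV F PF /cauchyP F_cauchy.
have /choice[x hx] k : exists x : V, F (ball x (invS k)).
  exact: F_cauchy (invS_gt0 k).
have [k l|y hy] := hV x.
  have [z []] := @filter_ex _ F PF _ (filterI (hx k) (hx l)).
  rewrite -!ball_normE /= => xz yz.
  have -> : x k - x l = (x k - z) - (x l - z) by rewrite opprB addrA subrK.
  by rewrite (le_trans (ler_normB _ _))// lerD// ltW.
apply/cvg_ex; exists y; apply/cvgrPdist_lt => e e0.
have [k hk] := invS_small (divr_gt0 e0 (ltr0Sn _ 1)).
apply: filterS (hx k) => z; rewrite -ball_normE/= => xz.
have -> : y - z = (x k - z) - (x k - y) by rewrite opprB [RHS]addrC addrA subrK.
rewrite (le_lt_trans (ler_normB _ _))// [ltRHS]splitr ltrD ?(lt_trans xz)//.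
by rewrite (le_lt_trans (hy _)).
Qed.

Lemma norm_Re_le z : `|complex.Re z|%:C%C <= `|z|.
Proof. exact: normc_ge_Re. Qed.

Lemma norm_Im_le z : `|complex.Im z|%:C%C <= `|z|.
Proof.
rewrite -normrN -ReiNIm (le_trans (norm_Re_le _))// normrM.
by rewrite [X in _ * X]normc_def/= expr0n/= add0r expr1n sqrtr1 mulr1.
Qed.

Lemma complex_complete (F : set_system R[i]^o) :
  ProperFilter F -> cauchy F -> cvg F.
Proof.
apply: seq_complete => x hx.
have lim (f : R[i] -> R) : (forall z w, f (z - w) = f z - f w) ->
    (forall z, `|f z|%:C%C <= `|z|) -> exists a : R, f \o x @ \oo --> a.
  move=> fB fle; apply/cvg_ex/cauchy_cvgP; apply: cauchy_exP => e e0.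
  have e0' : 0 < (e / 2)%:C%C by rewrite ltcR divr_gt0.
  have [N hN] := invS_small e0'.
  exists (f (x N)); exists N => // l /= Nl; rewrite -ball_normE/= -fB -ltcR.
  rewrite (le_lt_trans (fle _))// (le_lt_trans (hx _ _))//.
  rewrite [e]splitr rmorphD/= ltrD// (le_lt_trans _ hN)//.
  by rewrite lef_pV2 ?posrE ?ltr0n// ler_nat ltnS.
have [a ha] := lim (@complex.Re R) (fun z w => raddfB _ z w) norm_Re_le.
have [b hb] := lim (@complex.Im R) (fun z w => raddfB _ z w) norm_Im_le.
exists (a +i* b)%C => k; apply: (@le_eps _ _ 3) => // e e0.
have eR : (complex.Re e)%:C%C = e by rewrite RRe_real// gtr0_real.
have r0 : 0 < complex.Re e by rewrite -ltcR eR.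
have /cvgrPdist_lt/(_ _ r0)[N1 _ h1] := ha.
have /cvgrPdist_lt/(_ _ r0)[N2 _ h2] := hb.
have [N3 h3] := invS_small e0.
pose l := maxn (maxn N1 N2) N3.
have := h1 l (leq_trans (leq_maxl _ _) (leq_maxl _ _)).
have := h2 l (leq_trans (leq_maxr _ _) (leq_maxl _ _)).
rewrite /= -2!ltcR eR => {}h2 {}h1.
have {}h3 : invS l < e.
  apply: le_lt_trans h3; rewrite lef_pV2 ?posrE ?ltr0n// ler_nat ltnS.
  exact: leq_maxr.
have -> : x k - (a +i* b)%C = (x k - x l) + (x l - (a +i* b)%C).
  by rewrite addrA subrK.
rewrite (le_trans (ler_normD _ _))//.
have -> : invS k + e * 3 = (invS k + e) + (e + e) by ring.
rewrite lerD// ?(le_trans (hx _ _)) ?lerD2l ?(ltW h3)//.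
have -> : x l - (a +i* b)%C =
    - ((a - complex.Re (x l))%:C%C + 'i%C * (b - complex.Im (x l))%:C%C).
  by rewrite [in LHS](complexE (x l)) (complexE (a +i* b)%C)/= !rmorphB/=; ring.
rewrite normrN (le_trans (ler_normD _ _))// lerD//.
  by rewrite ltW// (le_lt_trans _ h1)// normc_def/= expr0n/= addr0 sqrtr_sqr.
rewrite normrM normc_def/= expr0n/= add0r expr1n sqrtr1 mul1r.
by rewrite ltW// (le_lt_trans _ h2)// normc_def/= expr0n/= addr0 sqrtr_sqr.
Qed.

End Scalars.

(* The canonical instances on R[i]^o are keyed on the regular algebra, where
   completeness is already attached to real scalars; hence this copy. *)
Definition complex_line (R : realType) : Type := R[i]^o.

HB.instance Definition _ (R : realType) :=
  NormedModule.copy (complex_line R) R[i]^o.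
HB.instance Definition _ (R : realType) :=
  Uniform_isComplete.Build (complex_line R) (@complex_complete R).

Section ComplexLine.
Context {R : realType}.

Lemma complex_cauchy_limit (x : nat -> R[i]) (c : R[i]) :
  0 <= c -> (forall k l, `|x k - x l| <= c * (invS k + invS l)) ->
  exists y, forall k, `|x k - y| <= c * invS k.
Proof. exact: (@cauchy_limit R (complex_line R)). Qed.

End ComplexLine.

Section MakeHilbert.
Context {R : realType} {V : completeNormedModType R[i]} {d : V -> V -> R[i]}.
Hypothesis d_linear : forall a x y z, d (a *: x + y) z = a * d x z + d y z.
Hypothesis d_herm : forall x y, d x y = (d y x)^*.
Hypothesis d_norm : forall x, `|x| ^+ 2 = d x x.

Let d_lin : bilinear_for *%R (Num.conj \; *%R) d.
Proof.
split=> [z a x y|z a x y] /=; first exact: d_linear.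
by rewrite d_herm d_linear rmorphD rmorphM/= -!d_herm.
Qed.

Let d_hermitian x y : d x y = (-1) ^+ false * (d y x)^*.
Proof. by rewrite mul1r. Qed.

Let d_gt0 x : x != 0 -> 0 < d x x.
Proof. by move=> x0; rewrite -d_norm exprn_gt0// normr_gt0. Qed.

Definition hilbert_dot : {dot V for Num.conj} := HB.pack_for {dot V for Num.conj} d
  (bilinear_isBilinear.Build _ _ _ _ _ _ d d_lin)
  (isHermitianSesquilinear.Build _ _ _ _ d d_hermitian)
  (isDotProduct.Build _ _ d d_gt0).

Definition make_hilbert : hilbertSpace R := @HilbertSpace R V hilbert_dot d_norm.

End MakeHilbert.

Section ComplexHilbert.
Context {R : realType}.
Implicit Types x y z : complex_line R.

Let cdot (x y : complex_line R) : R[i] := x * y^*.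

Let cdot_linear a x y z : cdot (a *: x + y) z = a * cdot x z + cdot y z.
Proof. by rewrite /cdot mulrDl -mulrA. Qed.

Let cdot_herm x y : cdot x y = (cdot y x)^*.
Proof. by rewrite /cdot rmorphM/= conjCK mulrC. Qed.

Let cdot_norm x : `|x| ^+ 2 = cdot x x.
Proof. by rewrite /cdot -normCK. Qed.

Definition complex_hilbert : hilbertSpace R :=
  make_hilbert cdot_linear cdot_herm cdot_norm.

End ComplexHilbert.

(** * Bounded operators and adjoints *)

Section Bounded.
Context {R : realType}.
Implicit Types H K L : hilbertSpace R.

Lemma norm_dot H (x : H) : hdot x x = `|x| ^+ 2.
Proof. by rewrite hnormE. Qed.

Lemma op_norm_leW H K (A : H -> K) c d :
  op_norm_le A c -> c <= d -> op_norm_le A d.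
Proof. by move=> hA cd x; rewrite (le_trans (hA x))// ler_wpM2r. Qed.

Lemma op_norm_leD H K (A B : H -> K) c d :
  op_norm_le A c -> op_norm_le B d -> op_norm_le (A + B) (c + d).
Proof.
by move=> hA hB x; rewrite (le_trans (ler_normD _ _))// mulrDl lerD.
Qed.

Lemma op_norm_leN H K (A : H -> K) c : op_norm_le A c -> op_norm_le (- A) c.
Proof. by move=> hA x; rewrite normrN. Qed.

Lemma op_norm_leB H K (A B : H -> K) c d :
  op_norm_le A c -> op_norm_le B d -> op_norm_le (A - B) (c + d).
Proof. by move=> hA hB; exact: op_norm_leD (op_norm_leN hB). Qed.

Lemma op_norm_leBC H K (A B : H -> K) c :
  op_norm_le (A - B) c -> op_norm_le (B - A) c.
Proof. by rewrite -(opprB A); exact: op_norm_leN. Qed.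

Lemma op_norm_leZ H K (A : H -> K) c (a : R[i]) :
  op_norm_le A c -> op_norm_le (a *: A) (`|a| * c).
Proof. by move=> hA x; rewrite normrZ -mulrA ler_wpM2l. Qed.

Lemma op_norm_le_comp H K L (A : K -> L) (B : H -> K) c d : 0 <= c ->
  op_norm_le A c -> op_norm_le B d -> op_norm_le (A \o B) (c * d).
Proof.
by move=> c0 hA hB x; rewrite (le_trans (hA _))// -mulrA ler_wpM2l.
Qed.

Lemma linear_comp H K L (A : K -> L) (B : H -> K) :
  linear A -> linear B -> linear (A \o B).
Proof. by move=> hA hB a x y /=; rewrite hB hA. Qed.

Lemma linearP_add H K (A B : H -> K) (a : R[i]) :
  linear A -> linear B -> linear (a *: A + B).
Proof.
move=> hA hB b x y; rewrite !fctE hA hB.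
rewrite !scalerDr !scalerA [a * b]mulrC -!addrA; congr (_ + _).
by rewrite addrCA.
Qed.

Lemma boundedP H K (A : H -> K) : bounded_operator H K A ->
  exists2 c, 0 < c & op_norm_le A c.
Proof.
move=> [_ [c hc]]; exists (`|c| + 1); first by rewrite ltr_wpDl.
move=> x; have [->|x0] := eqVneq x 0.
  by have := hc 0; rewrite normr0 !mulr0.
have x1 : 0 < `|x| by rewrite normr_gt0.
have c0 : 0 <= c by rewrite -(pmulr_lge0 _ x1) (le_trans _ (hc x)).
by rewrite (le_trans (hc x))// ler_wpM2r// (ger0_norm c0) lerDl.
Qed.

Lemma bounded_lin H K (A : H -> K) : bounded_operator H K A -> linear A.
Proof. by case. Qed.

Lemma bounded_add H K (A B : H -> K) (a : R[i]) : bounded_operator H K A ->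
  bounded_operator H K B -> bounded_operator H K (a *: A + B).
Proof.
move=> [hA [c hc]] [hB [d hd]]; split; first exact: linearP_add.
by exists (`|a| * c + d); apply: op_norm_leD hd; exact: op_norm_leZ.
Qed.

Lemma bounded_comp H K L (A : K -> L) (B : H -> K) : bounded_operator K L A ->
  bounded_operator H K B -> bounded_operator H L (A \o B).
Proof.
move=> hA hB; have [c /ltW c0 hc] := boundedP hA; have [d _ hd] := boundedP hB.
split; first exact: linear_comp (bounded_lin hA) (bounded_lin hB).
by exists (c * d); exact: op_norm_le_comp.
Qed.

Lemma bounded_id H : bounded_operator H H idfun.
Proof. by split=> //; exists 1 => x; rewrite mul1r. Qed.

Lemma bounded0 H K : bounded_operator H K 0.
Proof.
split.
  by move=> a x y; apply/esym; exact: (etrans (addr0 _) (scaler0 K a)).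
by exists 0 => x; rewrite mul0r [leLHS]normr0.
Qed.

Lemma bounded_sub H K (A B : H -> K) : bounded_operator H K A ->
  bounded_operator H K B -> bounded_operator H K (A - B).
Proof. by move=> hA hB; rewrite addrC -scaleN1r; exact: bounded_add. Qed.

Lemma op_norm_le0_eq H K (A : H -> K) (c : R[i]) : 0 <= c ->
  (forall e, 0 < e -> op_norm_le A (e * c)) -> A = 0.
Proof.
move=> c0 h; apply/funext => x; apply/eqP; rewrite -normr_le0.
apply: (@le_eps _ _ _ (c * `|x|)); first by rewrite mulr_ge0.
by move=> e e0; rewrite add0r mulrA; exact: h.
Qed.

Lemma op_complete H K (A : nat -> H -> K) :
  (forall k, bounded_operator H K (A k)) ->
  (forall k l, op_norm_le (A k - A l) (invS k + invS l)) ->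
  exists2 B, bounded_operator H K B & forall k, op_norm_le (A k - B) (invS k).
Proof.
move=> bA hA.
have /choice[B hB] x : exists y, forall k, `|A k x - y| <= `|x| * invS k.
  by apply: cauchy_limit => // k l; rewrite mulrC; exact: hA.
have hAB k : op_norm_le (A k - B) (invS k) by move=> x; rewrite mulrC; exact: hB.
exists B => //; split.
  move=> a x y; apply/eqP; rewrite -subr_eq0 -normr_le0.
  pose c := `|a *: x + y| + `|a| * `|x| + `|y|.
  apply: (@le_eps _ _ _ c); first by rewrite !addr_ge0 ?mulr_ge0.
  move=> e /invS_small[k /ltW hk].
  have c0 : 0 <= c by rewrite !addr_ge0 ?mulr_ge0.
  rewrite add0r (le_trans _ (ler_wpM2r c0 hk))//.
  have -> : B (a *: x + y) - (a *: B x + B y) =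
      - (A k (a *: x + y) - B (a *: x + y)) + a *: (A k x - B x) + (A k y - B y).
    by rewrite (bounded_lin (bA k)) scalerBr opprB -[RHS]addrA
      [X in _ = _ + X]addrACA -opprD addrA subrK.
  rewrite (le_trans (ler_normD _ _))// /c mulrDr lerD//; last first.
    by rewrite mulrC hB.
  rewrite (le_trans (ler_normD _ _))// mulrDr lerD//; last first.
    by rewrite normrZ mulrCA ler_wpM2l// mulrC hB.
  by rewrite normrN mulrC hB.
have [c _ hc] := boundedP (bA 0).
exists (c + invS 0) => x.
have -> : B x = A 0 x - (A 0 x - B x) by rewrite opprB addrC subrK.
by rewrite (le_trans (ler_normB _ _))// mulrDl lerD// hAB.
Qed.

Lemma adjoint_unique H K (A : H -> K) B B' :
  is_adjoint A B -> is_adjoint A B' -> B = B'.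
Proof.
move=> hB hB'; apply/funext => y; apply: dot_inj2 => x.
by rewrite dotC -hB hB' -dotC.
Qed.

Lemma adjoint_sym H K (A : H -> K) B : is_adjoint A B -> is_adjoint B A.
Proof. by move=> hB x y; rewrite dotC -hB -dotC. Qed.

Lemma adjoint_id H : is_adjoint (idfun : H -> H) idfun.
Proof. by []. Qed.

Lemma adjoint_comp H K L (A : K -> L) A' (B : H -> K) B' :
  is_adjoint A A' -> is_adjoint B B' -> is_adjoint (A \o B) (B' \o A').
Proof. by move=> hA hB x y /=; rewrite hA hB. Qed.

Lemma adjoint_add H K (A B : H -> K) A' B' (a : R[i]) :
  is_adjoint A A' -> is_adjoint B B' -> is_adjoint (a *: A + B) (a^* *: A' + B').
Proof.
move=> hA hB x y; rewrite !fctE dotDl dotDr dotZl dotZr conjCK.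
by rewrite hA hB.
Qed.

Lemma adjointB H K (A B : H -> K) A' B' :
  is_adjoint A A' -> is_adjoint B B' -> is_adjoint (A - B) (A' - B').
Proof. by move=> hA hB x y; rewrite !fctE dotBl dotBr hA hB. Qed.

Lemma adjoint_linear H K (A : H -> K) B : is_adjoint A B -> linear B.
Proof.
move=> hB a x y; apply: dot_inj2 => z.
rewrite dotDl dotZl 3?(dotC _ z) -!hB dotDr dotZr rmorphD rmorphM/= conjCK.
by rewrite -!dotC.
Qed.

Lemma op_norm_le_dot H K (A : H -> K) c : 0 <= c ->
  (forall x y, `|hdot (A x) y| <= c * `|x| * `|y|) -> op_norm_le A c.
Proof.
move=> c0 h x; have [->|A0] := eqVneq (A x) 0; first by rewrite normr0 mulr_ge0.
have A1 : 0 < `|A x| by rewrite normr_gt0.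
rewrite -(ler_pM2r A1) (le_trans _ (h x (A x)))//.
by rewrite norm_dot normrX normr_id expr2.
Qed.

Lemma op_norm_le_adjoint H K (A : H -> K) B c : 0 <= c -> is_adjoint A B ->
  op_norm_le A c -> op_norm_le B c.
Proof.
move=> c0 hB hA; apply: op_norm_le_dot => // x y.
rewrite dotC -hB norm_conjC (le_trans (dot_norm_le _ _))//.
by rewrite mulrAC ler_wpM2r.
Qed.

End Bounded.

(** * The Riesz representation theorem *)

Section Riesz.
Context {R : realType} {H : hilbertSpace R} {f : H -> R[i]}.
Hypothesis f_linear : forall a x y, f (a *: x + y) = a * f x + f y.
Hypothesis f_bounded : exists2 c : R[i], 0 <= c & forall x, `|f x| <= c * `|x|.

Let fD x y : f (x + y) = f x + f y.
Proof. by have := f_linear 1 x y; rewrite scale1r mul1r. Qed.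

Let f0 : f 0 = 0.
Proof. by apply: (@addrI _ (f 0)); rewrite -fD !addr0. Qed.

Let fZ a x : f (a *: x) = a * f x.
Proof. by have := f_linear a x 0; rewrite !addr0 f0 addr0. Qed.

Let q x : R[i] := `|x| ^+ 2 - (f x + (f x)^*).

Let q_real x : q x \is Num.real.
Proof.
apply: rpredB; first by rewrite ger0_real// exprn_ge0.
by apply/CrealP; rewrite rmorphD/= conjCK addrC.
Qed.

Let q_shift x w : q (x + w) = q x + `|w| ^+ 2 +
  ((hdot w x - f w) + (hdot w x - f w)^*).
Proof.
rewrite /q -!norm_dot dotDl !dotDr fD (dotC x w) !rmorphD rmorphN/=; ring.
Qed.

(* The representing vector minimises |x|^2 - 2 Re (f x). *)
Lemma riesz : exists z, forall x, f x = hdot x z.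
Proof.
have [c c0 fc] := f_bounded.
pose g x := complex.Re (q x).
have gE x : (g x)%:C%C = q x by rewrite RRe_real.
have q_ge x : - c ^+ 2 <= q x.
  rewrite -subr_ge0 (_ : q x - - c ^+ 2 = (`|x| - c) ^+ 2 + (2 * (c * `|x|) -
    (f x + (f x)^*))); last by rewrite /q; ring.
  rewrite addr_ge0//.
    by rewrite -realEsqr rpredB ?ger0_real.
  rewrite subr_ge0 (_ : f x + _ = - (- f x + (- f x)^*)); last first.
    by rewrite rmorphN/=; ring.
  rewrite (le_trans (ge_norm_addC _))// normrN ler_wpM2l//.
have c2 : (complex.Re (c ^+ 2))%:C%C = c ^+ 2.
  by rewrite RRe_real// ger0_real// exprn_ge0.
pose E := range g.
have lbE : has_lbound E.
  exists (- complex.Re (c ^+ 2)) => _ [x _ <-].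
  by rewrite -lecR gE rmorphN/= c2.
have infE : has_inf E by split=> //; exists (g 0); exists 0.
pose d : R[i] := (inf E)%:C%C.
have qd x : d <= q x by rewrite -gE lecR; apply: ge_inf => //; exists x.
(* The tolerance is chosen for the parallelogram law below, which then bounds [|x k - x l|^2] by
   [invS k ^+ 2 + invS l ^+ 2]. *)
have /choice[x hx] k : exists x, q x <= d + invS k ^+ 2 / 2.
  have e0 : 0 < k.+1%:R ^-2 / 2 :> R by rewrite divr_gt0// invr_gt0 exprn_gt0.
  have [_ [x _ <-] hx] := inf_adherent e0 infE.
  exists x; rewrite -gE ltW//; move: hx; rewrite -ltcR rmorphD/=.
  by rewrite fmorph_div fmorphV/= rmorphXn !rmorph_nat exprVn.
have [k l|z hz] := @cauchy_limit _ H x 1 ler01.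
  have e0 m : 0 <= @invS R m by rewrite ltW// invS_gt0.
  rewrite mul1r -(@ler_pXn2r _ 2)// ?nnegrE ?addr_ge0//.
  have -> : `|x k - x l| ^+ 2 =
      2 * q (x k) + 2 * q (x l) - 4 * q (2^-1 *: (x k + x l)).
    rewrite /q -!norm_dot dotZl dotZr dotBl !dotBr dotDl !dotDr fZ fD.
    rewrite !(rmorphM, rmorphD)/= fmorphV/= rmorph_nat.
    by field.
  rewrite (@le_trans _ _ (2 * (d + invS k ^+ 2 / 2) + 2 * (d + invS l ^+ 2 / 2)
     - 4 * d))//.
    by rewrite !lerD ?ler_wpM2l// ?lerN2 ?ler_wpM2l.
  rewrite (_ : _ - _ = invS k ^+ 2 + invS l ^+ 2); last by field.
  by rewrite sqrrD addrAC lerDl mulrn_wge0// mulr_ge0.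
(* This is [q_shift] at the almost minimal [x k], passed to the limit: the first variation at
   [z]. *)
have min w : 0 <= `|w| ^+ 2 + ((hdot w z - f w) + (hdot w z - f w)^*).
  rewrite -oppr_le0.
  apply: (@le_eps _ _ _ (2^-1 + 2 * `|w|)).
    by rewrite addr_ge0 ?invr_ge0// mulr_ge0.
  move=> e /invS_small[k /ltW ke]; rewrite add0r.
  apply: (@le_trans _ _ (invS k * (2^-1 + 2 * `|w|))); last first.
    by rewrite ler_wpM2r// addr_ge0 ?invr_ge0// mulr_ge0.
  have h1 : 0 <= `|w| ^+ 2 + ((hdot w (x k) - f w) + (hdot w (x k) - f w)^*) +
      invS k ^+ 2 / 2.
    have := le_trans (hx k) (lerD (qd (x k + w)) (lexx (invS k ^+ 2 / 2))).
    by rewrite q_shift -subr_ge0; congr (0 <= _); ring.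
  have h2 := ge_norm_addC (hdot w (z - x k)).
  have h3 : `|hdot w (z - x k)| <= `|w| * invS k.
    rewrite (le_trans (dot_norm_le _ _))// ler_wpM2l// distrC.
    by have := hz k; rewrite mul1r.
  have h4 : invS k ^+ 2 / 2 <= invS k * 2^-1 :> R[i].
    rewrite ler_pM2r ?invr_gt0// expr2 ler_piMr ?(ltW (invS_gt0 _))//.
    by rewrite /invS invf_le1 ?ler1n// ltr0n.
  rewrite -subr_ge0.
  rewrite (_ : _ - _ = (`|w| ^+ 2 + ((hdot w (x k) - f w) +
     (hdot w (x k) - f w)^*) + invS k ^+ 2 / 2) +
     (2 * (`|w| * invS k) + (hdot w (z - x k) + (hdot w (z - x k))^*)) +
     (invS k * 2^-1 - invS k ^+ 2 / 2)); last first.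
    by rewrite dotBr !(rmorphB, rmorphD)/=; ring.
  apply: addr_ge0; last by rewrite subr_ge0.
  apply: addr_ge0 => //.
  rewrite -[hdot w (z - x k) + _]opprK subr_ge0 (le_trans h2)//.
  by rewrite ler_wpM2l.
exists z => u; apply/eqP; rewrite eq_sym -subr_eq0 -normr_eq0 -sqrf_eq0.
set D := hdot u z - f u.
have : 2 * `|D| ^+ 2 <= 0.
  apply: (@small_slope _ (`|D| ^+ 2 * `|u| ^+ 2)); first by rewrite mulr_ge0.
  (* Along [w = - t D^* u] the variation is [t^2 |D|^2 |u|^2 - 2 t |D|^2], which stays nonnegative
     for all small [t] only if [D = 0]. *)
  move=> t t0; have := min (- t * D^* *: u).
  rewrite normrZ fZ dotZl -mulrBr -/D !normrM normrN norm_conjC.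
  rewrite (gtr0_norm t0) !rmorphM rmorphN/= conjCK (geC0_conj (ltW t0)) -subr_ge0.
  by congr (0 <= _); rewrite !exprMn !normCK; ring.
rewrite pmulr_rle0// => h; rewrite eq_le h/=.
by rewrite exprn_ge0.
Qed.

End Riesz.

Lemma adjoint_exists (R : realType) (H K : hilbertSpace R) (A : H -> K) :
  bounded_operator H K A -> exists2 B, is_adjoint A B & bounded_operator K H B.
Proof.
move=> bA; have [c /ltW c0 hc] := boundedP bA.
have /choice[B hB] (y : K) : exists z, forall x, hdot (A x) y = hdot x z.
  apply: riesz => [a x x'|]; first by rewrite (bounded_lin bA) dotDl dotZl.
  exists (c * `|y|); first by rewrite mulr_ge0.
  move=> x; rewrite (le_trans (dot_norm_le _ _))// mulrAC ler_wpM2r//.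
have AB : is_adjoint A B by move=> x y; rewrite hB.
exists B => //; split; first exact: adjoint_linear AB.
by exists c; exact: op_norm_le_adjoint AB hc.
Qed.

(** * Positive matrices of operators and of functions *)

Section Blocks.
Context {R : realType}.

Definition block2 (V : Type) (d u u' : V) : 'M[V]_2 :=
  \matrix_(i, j) if i == j then d else if i == 0 then u else u'.

Definition shift_diag (V : lmodType R[i]) n (c : R[i]) (one : V) (Q : 'M[V]_n) :
    'M[V]_n :=
  \matrix_(i, j) (Q i j + (if i == j then c else 0) *: one).

End Blocks.

Section OpPos.
Context {R : realType} {H : hilbertSpace R}.

Lemma op_pos2 (P : 'M[H -> H]_2) : op_pos P <->
  forall x y, 0 <= hdot (P 0 0 x) x + hdot (P 0 1 y) x +
                   (hdot (P 1 0 x) y + hdot (P 1 1 y) y).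
Proof.
have e : lift ord0 ord0 = 1 :> 'I_2 by apply/val_inj.
split=> [h x y|h v].
  have := h (fun i => if i == 0 then x else y).
  by rewrite !big_ord_recl !big_ord0 /= !addr0 e.
by rewrite !big_ord_recl !big_ord0 /= !addr0 e.
Qed.

Lemma op_pos1 (P : 'M[H -> H]_1) : op_pos P <->
  forall x, 0 <= hdot (P 0 0 x) x.
Proof.
split=> [h x|h v]; last by rewrite !big_ord1.
by have := h (fun=> x); rewrite !big_ord1.
Qed.

(* A positive block forces the off-diagonal entries to be adjoint to each other
   (the form is real), and evaluating it at (- c^-1 A x, x) bounds |A x|. *)
Lemma op_pos_block2 (A A' : H -> H) (c : R[i]) : 0 <= c ->
  linear A -> linear A' ->
  op_pos (block2 (c *: idfun) A A') <-> is_adjoint A A' /\ op_norm_le A c.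
Proof.
move=> c0 lA lA'; rewrite op_pos2 !mxE /=; split=> [h|[hA nA] x y].
  have hA : is_adjoint A A'.
    move=> x y; rewrite -[RHS]conjCK -dotC.
    set z := hdot (A x) y; set w := hdot (A' y) x.
    have re u : hdot (A x) u + hdot (A' u) x \is Num.real.
      have := ger0_real (h u x).
      rewrite !fctE !dotZl !norm_dot.
      rewrite (_ : _ + _ = (c * `|u| ^+ 2 + c * `|x| ^+ 2) +
        (hdot (A x) u + hdot (A' u) x)); last by ring.
      have r : c * `|u| ^+ 2 + c * `|x| ^+ 2 \is Num.real.
        by rewrite ger0_real// addr_ge0// mulr_ge0// exprn_ge0.
      by rewrite rpredDl.
    (* Reality at [y] and at ['i *: y] compares real and imaginary parts and yields [z = w^*]. *)
    have /CrealP := re y; have /CrealP := re ('i *: y).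
    rewrite (linZ lA') dotZl dotZr conjCi -/z -/w !rmorphD !rmorphM rmorphN/= conjCi.
    move=> h1 h2.
    have {}h1 : z^* - w^* = w - z.
      apply: (@mulfI _ 'i (neq0Ci _)); rewrite !mulrBr.
      by move: h1; rewrite opprK !mulNr addrC => ->; rewrite addrC.
    have : 2 * z = 2 * w^*.
      have -> : 2 * z = (z + w) - (w - z) by ring.
      by rewrite -h1 -h2; ring.
    by apply: mulfI; rewrite pnatr_eq0.
  split=> // x.
  have key t : 0 <= t -> 2 * t * `|A x| ^+ 2 <=
      c * t ^+ 2 * `|A x| ^+ 2 + c * `|x| ^+ 2.
    move=> t0; have := h (- t *: A x) x.
    rewrite !fctE (linZ lA') !dotZl !dotZr (adjoint_sym hA).
    rewrite !norm_dot rmorphN/= (geC0_conj t0) -subr_ge0.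
    by congr (0 <= _); ring.
  (* The useful value of [t] is [c^-1]; for [c = 0] any positive [t] does. *)
  move: c0; rewrite le_eqVlt => /predU1P[c0|c0].
    have := key 1 ler01; rewrite -c0 !mul0r addr0 mulr1.
    rewrite pmulr_rle0// => A0.
    have /eqP : `|A x| ^+ 2 = 0 by apply/eqP; rewrite eq_le A0 exprn_ge0.
    by rewrite expf_eq0/= => /eqP ->.
  have /(ler_wpM2l (ltW c0)) := key c^-1 (ltW (etrans (invr_gt0 c) c0)).
  rewrite -(@ler_pXn2r _ 2 isT `|A x|) ?nnegrE ?mulr_ge0 ?(ltW c0)//.
  rewrite -subr_ge0 => h1; rewrite -subr_ge0; move: h1.
  have cn := gt_eqF c0.
  by congr (0 <= _); field; rewrite cn.
rewrite !fctE !dotZl !norm_dot.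
have -> : hdot (A' x) y = (hdot (A y) x)^* by rewrite hA -dotC.
rewrite (_ : _ + _ = c * (`|x| - `|y|) ^+ 2 + (2 * (c * `|y| * `|x|) +
   (hdot (A y) x + (hdot (A y) x)^*))); last by ring.
apply: addr_ge0.
  by rewrite mulr_ge0// -realEsqr rpredB ?ger0_real.
rewrite -[hdot (A y) x + _]opprK subr_ge0 (le_trans (ge_norm_addC _))//.
by rewrite ler_wpM2l// (le_trans (dot_norm_le _ _))// ler_wpM2r.
Qed.

Lemma op_form_bound n (D : 'M[H -> H]_n) (e : R[i]) (h : 'I_n -> H) :
  (forall i j, op_norm_le (D i j) e) ->
  `|\sum_i \sum_j hdot (D i j (h j)) (h i)| <= e * \sum_i \sum_j (`|h j| * `|h i|).
Proof.
move=> hD; rewrite mulr_sumr (le_trans (ler_norm_sum _ _ _))// ler_sum// => i _.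
rewrite mulr_sumr (le_trans (ler_norm_sum _ _ _))// ler_sum// => j _.
by rewrite (le_trans (dot_norm_le _ _))// mulrA ler_wpM2r//; exact: hD.
Qed.

Lemma op_pos_closed n (P : 'M[H -> H]_n) :
  (forall e : R[i], 0 < e -> exists2 Q, op_pos Q &
     forall i j, op_norm_le (P i j - Q i j) e) -> op_pos P.
Proof.
move=> hP h; pose c : R[i] := \sum_i \sum_j (`|h j| * `|h i|).
have c0 : 0 <= c by do 2!apply: sumr_ge0 => ? _; rewrite mulr_ge0.
apply: (ge0_closed c0) => e /hP[Q Qpos PQ].
exists (\sum_i \sum_j hdot (Q i j (h j)) (h i)); first exact: Qpos.
rewrite (_ : _ - _ =
    \sum_i \sum_j hdot ((\matrix_(i, j) (P i j - Q i j)) i j (h j)) (h i)).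
  by apply: op_form_bound => i j; rewrite mxE; exact: PQ.
rewrite -sumrB; apply: eq_bigr => i _; rewrite -sumrB; apply: eq_bigr => j _.
by rewrite mxE dotBl.
Qed.

(* Summing the positive 2 x 2 blocks over all (i, j) counts every entry of
   Q - P twice and every diagonal term 2n times. *)
Lemma op_pos_perturb n (P Q : 'M[H -> H]_n) (e : R[i]) : 0 <= e ->
  op_pos P ->
  (forall i j, is_adjoint (Q i j - P i j) (Q j i - P j i)) ->
  (forall i j, op_norm_le (Q i j - P i j) e) ->
  op_pos (shift_diag (e * n%:R) idfun Q).
Proof.
move=> e0 Ppos adj nrm h.
pose D i j := Q i j - P i j.
have -> : \sum_i \sum_j hdot ((shift_diag (e * n%:R) idfun Q) i j (h j)) (h i) =
    \sum_i \sum_j hdot (P i j (h j)) (h i) +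
    (\sum_i \sum_j hdot (D i j (h j)) (h i) + e * n%:R * \sum_i hdot (h i) (h i)).
  rewrite addrA -big_split /= mulr_sumr -big_split; apply: eq_bigr => i _ /=.
  rewrite -big_split /=.
  have -> : e * n%:R * hdot (h i) (h i) =
      \sum_j (if i == j then e * n%:R else 0) * hdot (h j) (h i).
    rewrite (bigD1 i)//= eqxx big1 ?addr0// => j ji.
    by rewrite eq_sym (negPf ji) mul0r.
  rewrite -big_split; apply: eq_bigr => j _ /=.
  by rewrite mxE !fctE dotDl dotZl dotBl [X in _ = X + _]addrC subrK.
apply: addr_ge0; first exact: Ppos.
suff : 0 <= 2 * (\sum_i \sum_j hdot (D i j (h j)) (h i) +
    e * n%:R * \sum_i hdot (h i) (h i)) by rewrite pmulr_rge0.
have -> : 2 * (\sum_i \sum_j hdot (D i j (h j)) (h i) +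
    e * n%:R * \sum_i hdot (h i) (h i)) =
  \sum_i \sum_j ((e * hdot (h i) (h i) + hdot (D i j (h j)) (h i)) +
                 (hdot (D j i (h i)) (h j) + e * hdot (h j) (h j))).
  have -> : \sum_i \sum_j ((e * hdot (h i) (h i) + hdot (D i j (h j)) (h i)) +
                 (hdot (D j i (h i)) (h j) + e * hdot (h j) (h j))) =
      \sum_i (\sum_(j < n) e * hdot (h i) (h i) + \sum_j hdot (D i j (h j)) (h i)) +
      \sum_i (\sum_j hdot (D j i (h i)) (h j) + \sum_j e * hdot (h j) (h j)).
    by rewrite -big_split; apply: eq_bigr => i _; rewrite -!big_split.
  rewrite !big_split/= [X in _ = _ + (X + _)]exchange_big/=.
  under [X in _ = X + _ + _]eq_bigr do rewrite sumr_const card_ord -mulr_natr.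
  rewrite sumr_const card_ord -mulr_natr -mulr_suml -!mulr_sumr; ring.
apply: sumr_ge0 => i _; apply: sumr_ge0 => j _.
have /op_pos2/(_ (h i) (h j)) : op_pos (block2 (e *: idfun) (D i j) (D j i)).
  apply/(op_pos_block2 e0 (adjoint_linear (adj j i)) (adjoint_linear (adj i j))).
  by split; [exact: adj | exact: nrm].
by rewrite !mxE/= !fctE !dotZl.
Qed.

End OpPos.

Section FunPos.
Context {R : realType} {X : topologicalType}.

(** Scalars act on the one-dimensional Hilbert space: positivity of the matrix [F(x)] is operator
    positivity there, so the results on [op_pos] apply point by point. *)
Let mulop (a : R[i]) : @complex_hilbert R -> @complex_hilbert R := fun z => a * z.

Let mulop_linear a : linear (mulop a).
Proof.
move=> b x y; rewrite /mulop -[b *: x + y]/((b : R[i]) * x + y : R[i]).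
by rewrite mulrDr mulrCA.
Qed.

Let mulop_adjoint a b : is_adjoint (mulop a) (mulop b) <-> b = a^*.
Proof.
split=> [|-> x y].
  move=> /(_ 1 1); rewrite /hdot/= /mulop !mulr1 mul1r rmorph1 mulr1 => ->.
  by rewrite conjCK.
by rewrite /hdot/= /mulop rmorphM/= conjCK mulrAC mulrC mulrA.
Qed.

Let mulop_norm a c : op_norm_le (mulop a) c <-> `|a| <= c.
Proof.
split=> [/(_ 1)|h x]; first by rewrite /mulop mulr1 normr1 mulr1.
by rewrite /mulop normrM ler_wpM2r.
Qed.

Let mulop_mx n (F : 'M[Cfun R X]_n) (x : X) := map_mx (fun f => mulop (f x)) F.

Let fun_posE n (F : 'M[Cfun R X]_n) :
  fun_pos F <-> forall x, op_pos (mulop_mx F x).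
Proof.
split=> h x v; have := h x v.
  by congr (0 <= _); do 2!(apply: eq_bigr => ? _); rewrite !mxE.
by congr (0 <= _); do 2!(apply: eq_bigr => ? _); rewrite !mxE.
Qed.

Lemma fun_pos_block2 (f f' : Cfun R X) (c : R[i]) : 0 <= c ->
  fun_pos (block2 (c *: (cst 1 : Cfun R X)) f f') <->
  forall x, f' x = (f x)^* /\ `|f x| <= c.
Proof.
move=> c0; rewrite fun_posE.
have e x : mulop_mx (block2 (c *: (cst 1 : Cfun R X)) f f') x =
    block2 (c *: idfun) (mulop (f x)) (mulop (f' x)).
  apply/matrixP => i j; rewrite !mxE; case: ifP => _; last by case: ifP.
  by apply/funext => z; exact: (congr1 (fun t => t * z) (mulr1 c)).
by split=> h x; have := h x; rewrite e op_pos_block2// mulop_adjoint mulop_norm.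
Qed.

Lemma fun_pos_closed n (F : 'M[Cfun R X]_n) :
  (forall e : R[i], 0 < e -> exists2 G : 'M[Cfun R X]_n, fun_pos G &
     forall i j x, `|F i j x - G i j x| <= e) -> fun_pos F.
Proof.
move=> h; apply/fun_posE => x; apply: op_pos_closed => e /h[G Gpos FG].
exists (mulop_mx G x); first by move/fun_posE: Gpos.
move=> i j; have /mulop_norm hij := FG i j x => z.
by have := hij z; rewrite !mxE !fctE /mulop mulrBl.
Qed.

Lemma fun_pos_perturb n (F G : 'M[Cfun R X]_n) (e : R[i]) : 0 <= e ->
  fun_pos F ->
  (forall i j x, G j i x - F j i x = (G i j x - F i j x)^*) ->
  (forall i j x, `|G i j x - F i j x| <= e) ->
  fun_pos (shift_diag (e * n%:R) (cst 1 : Cfun R X) G).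
Proof.
move=> e0 Fpos herm nrm; apply/fun_posE => x.
have mB i j : (mulop_mx G x) i j - (mulop_mx F x) i j = mulop (G i j x - F i j x).
  by apply/funext => z; rewrite !mxE !fctE /mulop mulrBl.
have : op_pos (shift_diag (e * n%:R) idfun (mulop_mx G x)).
  apply: (@op_pos_perturb _ _ _ (mulop_mx F x)) => //; first by move/fun_posE: Fpos.
    by move=> i j; rewrite !mB; apply/mulop_adjoint.
  by move=> i j; rewrite !mB; apply/mulop_norm.
apply: (_ : forall M N, M = N -> op_pos M -> op_pos N); first by move=> M N ->.
apply/matrixP => i j; rewrite !mxE; apply/funext => z.
rewrite /mulop [RHS]mulrDl.
by congr (_ + _); exact: (esym (congr1 (fun t => t * z) (mulr1 _))).
Qed.

Lemma uniform_limit (f : nat -> X -> R[i]^o) : (forall k, continuous (f k)) ->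
  (forall k l x, `|f k x - f l x| <= invS k + invS l) ->
  exists2 g : X -> R[i]^o, continuous g & forall k x, `|f k x - g x| <= invS k.
Proof.
move=> cf hf.
have /choice[g hg] x : exists y : R[i], forall k, `|f k x - y| <= 1 * invS k.
  by apply: complex_cauchy_limit => // k l; rewrite mul1r.
have {}hg k x : `|f k x - g x| <= invS k by rewrite -[leRHS]mul1r.
exists g => // x; apply/cvgrPdist_lt => e e0.
have e3 : 0 < e / 3 by rewrite divr_gt0.
have [k hk] := invS_small e3.
have /cvgrPdist_lt/(_ _ e3) := cf k x.
apply: filterS => y hy.
rewrite (_ : g x - g y = - (f k x - g x) + (f k x - f k y) + (f k y - g y)); last first.
  by ring.
rewrite (_ : e = e / 3 + e / 3 + e / 3); last by field.
rewrite (le_lt_trans (ler_normD _ _))// ltrD//; last exact: le_lt_trans (hg _ _) hk.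
rewrite (le_lt_trans (ler_normD _ _))// ltrD// normrN.
exact: le_lt_trans (hg _ _) hk.
Qed.

Lemma compact_fun_bounded (f : X -> R[i]^o) : compact [set: X] -> continuous f ->
  exists2 c : R[i], 0 < c & forall x, `|f x| <= c.
Proof.
move=> cX cf.
have cfX : compact (f @` setT).
  by apply: continuous_compact => //; exact: continuous_subspaceT.
move: cfX; rewrite compact_cover.
move=> /(_ nat setT (fun n => ball (0 : R[i]^o) (n.+1%:R : R[i])))[|z _|D _ hD].
- by move=> n _; exact: ball_open.
- have [n hn] : exists n, invS n < (1 + `|z|)^-1.
    by apply: invS_small; rewrite invr_gt0 ltr_wpDr.
  exists n => //; rewrite -ball_normE /= sub0r normrN.
  rewrite ltf_pV2 ?posrE ?ltr0n ?ltr_wpDr// in hn.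
  by rewrite (lt_trans _ hn)// ltrDr.
exists (\max_(i <- finmap.enum_fset D) i).+1%:R; first by rewrite ltr0n.
move=> x; have [|n /= nD] := hD (f x); first by exists x.
rewrite -ball_normE /= sub0r normrN => /ltW/le_trans; apply.
by rewrite ler_nat ltnS leq_bigmax_seq.
Qed.

End FunPos.

(** * Embeddings of function systems *)

Section Extension.
Context {R : realType} {X : topologicalType} {S : set (Cfun R X)}.
Context {H : hilbertSpace R} {phi : Cfun R X -> Bop H}.
Hypothesis cptX : compact [set: X].
Hypothesis fsS : function_system S.
Hypothesis hphi :
  unital_complete_order_embedding S (bounded_operator H H : set (Bop H)) phi.
Implicit Types (f g : Cfun R X) (A B : H -> H).

Let one : Cfun R X := cst 1.

Let S_linear a f g : S f -> S g -> S (a *: f + g).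
Proof. by move=> Sf Sg; case: fsS => _ [_ h] _ _ _; exact: h. Qed.

Let S0 : S 0.
Proof. by case: fsS => _ []. Qed.

Let S1 : S one.
Proof. by case: fsS. Qed.

Let SZ a f : S f -> S (a *: f).
Proof. by move=> Sf; rewrite -[_ *: _]addr0; exact: S_linear. Qed.

Let S_conj f : S f -> S (fun x => (f x)^*).
Proof. by move=> Sf; case: fsS => _ _ h _ _; exact: h. Qed.

Let phi_bounded f : S f -> bounded_operator H H (phi f).
Proof. by move=> Sf; case: hphi => h _ _ _ _; exact: h. Qed.

Let phi_lin a f g : S f -> S g -> phi (a *: f + g) = a *: phi f + phi g.
Proof. by move=> Sf Sg; case: hphi => _ h _ _ _; exact: h. Qed.

Let phi0 : phi 0 = 0.
Proof.
have := phi_lin (-1) S0 S0; rewrite scaleN1r addNr => ->.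
by rewrite scaleN1r addNr.
Qed.

Let phiZ a f : S f -> phi (a *: f) = a *: phi f.
Proof. by move=> Sf; rewrite -[a *: f]addr0 phi_lin// phi0 addr0. Qed.

Let phi1 : phi one = idfun.
Proof. by case: hphi. Qed.

Let phiB f g : S f -> S g -> phi (f - g) = phi f - phi g.
Proof.
by move=> Sf Sg; rewrite addrC -scaleN1r phi_lin// scaleN1r addrC.
Qed.

Let SB f g : S f -> S g -> S (f - g).
Proof. by move=> Sf Sg; rewrite addrC -scaleN1r; exact: S_linear. Qed.

Let phi_pos n (F : 'M[Cfun R X]_n) : (forall i j, S (F i j)) ->
  fun_pos F <-> op_pos (map_mx phi F).
Proof. by case: hphi => _ _ _ _ h; exact: h. Qed.

Let phi_block f f' (c : R[i]) : 0 <= c -> S f -> S f' ->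
  (forall x, f' x = (f x)^* /\ `|f x| <= c) <->
  is_adjoint (phi f) (phi f') /\ op_norm_le (phi f) c.
Proof.
move=> c0 Sf Sf'.
rewrite -(fun_pos_block2 f f' c0) -op_pos_block2//; last 2 first.
- exact: bounded_lin (phi_bounded Sf).
- exact: bounded_lin (phi_bounded Sf').
rewrite phi_pos; last by move=> i j; rewrite mxE; case: ifP => _; [exact: SZ|case: ifP].
rewrite (_ : map_mx _ _ = block2 (c *: idfun) (phi f) (phi f'))//.
apply/matrixP => i j; rewrite !mxE; case: ifP => _; last by case: ifP.
by rewrite phiZ// phi1.
Qed.

(** The block criterion compares a bound together with an adjoint relation. A first use, with any
    bound [d] given by compactness, supplies the adjoint relation that the converse direction
    needs. *)
Lemma embedding_norm f (c : R[i]) : 0 <= c -> S f ->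
  (forall x, `|f x| <= c) <-> op_norm_le (phi f) c.
Proof.
move=> c0 Sf; have Sf' := S_conj Sf.
have [d /ltW d0 fd] : exists2 d : R[i], 0 < d & forall x, `|f x| <= d.
  by apply: compact_fun_bounded => //; case: fsS => h _ _ _ _; exact: h.
have [adj _] : is_adjoint (phi f) (phi (fun x => (f x)^*)) /\ op_norm_le (phi f) d.
  by apply/(phi_block d0 Sf Sf').
split=> [fc|fc].
  by have [] : is_adjoint (phi f) (phi (fun x => (f x)^*)) /\ op_norm_le (phi f) c
    by apply/(phi_block c0 Sf Sf').
by move=> x; have /(phi_block c0 Sf Sf')/(_ x)[] := conj adj fc.
Qed.

Lemma embedding_adjoint f : S f -> is_adjoint (phi f) (phi (fun x => (f x)^*)).
Proof.
move=> Sf; have Sf' := S_conj Sf.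
have [d /ltW d0 fd] : exists2 d : R[i], 0 < d & forall x, `|f x| <= d.
  by apply: compact_fun_bounded => //; case: fsS => h _ _ _ _; exact: h.
by have [] : is_adjoint (phi f) (phi (fun x => (f x)^*)) /\ op_norm_le (phi f) d
  by apply/(phi_block d0 Sf Sf').
Qed.

Lemma embedding_concrete : concrete_operator_system (phi @` S : set (H -> H)).
Proof.
split=> [_ [f Sf <-]||B [_ [f Sf <-] adj]|]; first exact: phi_bounded.
- split; first by exists 0.
  by move=> a _ _ [f Sf <-] [g Sg <-]; exists (a *: f + g); [exact: S_linear|rewrite phi_lin].
- exists (fun x => (f x)^*); first exact: S_conj.
  exact: adjoint_unique (embedding_adjoint Sf) adj.
by exists one.
Qed.

(** The closure of the graph of [phi]: a single [g] approximates on both sides. As a relation it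
    needs no choice of values and is symmetric in functions and operators. *)
Definition closed_graph f A : Prop :=
  [/\ continuous f, bounded_operator H H A & forall e : R[i], 0 < e ->
    exists g, [/\ S g, forall x, `|f x - g x| <= e & op_norm_le (A - phi g) e]].

Lemma closed_graph_fun f A : closed_graph f A -> sup_closure S f.
Proof. by case=> cf _ h; split=> // e /h[g [Sg fg _]]; exists g. Qed.

Lemma closed_graph_op f A : closed_graph f A -> op_closure (phi @` S) A.
Proof.
by case=> _ bA h; split=> // e /h[g [Sg _ Ag]]; exists (phi g) => //; exists g.
Qed.

Lemma closed_graph_phi f : S f -> closed_graph f (phi f).
Proof.
move=> Sf; split; [by case: fsS => h _ _ _ _; exact: h|exact: phi_bounded|].
move=> e e0; exists f; split=> // x; first by rewrite subrr normr0 ltW.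
by rewrite !fctE subrr normr0 mulr_ge0// ltW.
Qed.

(** Since [phi] is isometric, an approximating sequence is Cauchy on one side exactly when it is on
    the other; surjectivity below is the same argument read backwards. *)
Lemma closed_graph_total f : sup_closure S f -> exists A, closed_graph f A.
Proof.
move=> [cf hf].
have /choice[g hg] k : exists g, S g /\ forall x, `|f x - g x| <= invS k.
  by have [g Sg fg] := hf _ (invS_gt0 k); exists g.
have Sg k : S (g k) by case: (hg k).
have fg k x : `|f x - g k x| <= invS k by case: (hg k).
have [k|k l|A bA hA] := op_complete (A := fun k => phi (g k)).
- exact: phi_bounded.
- rewrite -phiB//; apply/embedding_norm => [||x]; last first.
  + rewrite (_ : (g k - g l) x = (f x - g l x) - (f x - g k x)).
      by rewrite (le_trans (ler_normB _ _))// addrC lerD.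
    by rewrite opprB [RHS]addrC addrA subrK.
  + exact: SB.
  + by rewrite addr_ge0// ltW// invS_gt0.
exists A; split=> // e /invS_small[k /ltW hk]; exists (g k); split=> // [x|].
  exact: le_trans (fg k x) hk.
by apply: op_norm_leBC; exact: op_norm_leW (hA k) hk.
Qed.

Lemma closed_graph_onto A : op_closure (phi @` S) A -> exists f, closed_graph f A.
Proof.
move=> [bA hA].
have /choice[g hg] k : exists g, S g /\ op_norm_le (A - phi g) (invS k).
  by have [_ [g Sg <-] fg] := hA _ (invS_gt0 k); exists g.
have Sg k : S (g k) by case: (hg k).
have Ag k : op_norm_le (A - phi (g k)) (invS k) by case: (hg k).
have [k|k l|f cf hf] := uniform_limit (f := g).
- by case: fsS => h _ _ _ _; exact: h.
- apply/(@embedding_norm (g k - g l)); [|exact: SB|].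
    by rewrite addr_ge0// ltW// invS_gt0.
  rewrite phiB// (_ : _ - _ = (A - phi (g l)) - (A - phi (g k))).
    by rewrite [X in op_norm_le _ X]addrC; exact: op_norm_leB.
  by rewrite opprB [RHS]addrC addrA subrK.
exists f; split=> // e /invS_small[k /ltW hk]; exists (g k); split=> // [x|].
  by rewrite distrC; exact: le_trans (hf k x) hk.
exact: op_norm_leW (Ag k) hk.
Qed.

Lemma closed_graph_linear a f g A B : closed_graph f A -> closed_graph g B ->
  closed_graph (a *: f + g) (a *: A + B).
Proof.
move=> [cf bA hf] [cg bB hg]; split; [|exact: bounded_add|].
  by move=> x; apply: (@cvgD _ R[i]^o); [apply: cvgZr; exact: cf|exact: cg].
move=> e e0; pose d := e / (`|a| + 1).
have a0 : 0 < `|a| + 1 by rewrite ltr_wpDl.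
have d0 : 0 < d by rewrite divr_gt0.
have dE : `|a| * d + d = e by rewrite /d; field; exact/lt0r_neq0.
have [f' [Sf' ff' Af']] := hf _ d0; have [g' [Sg' gg' Bg']] := hg _ d0.
exists (a *: f' + g'); split=> [|x|]; first exact: S_linear.
  rewrite -dE (_ : _ - _ = a * (f x - f' x) + (g x - g' x)); last first.
    by rewrite !fctE /GRing.scale/=; ring.
  by rewrite (le_trans (ler_normD _ _))// lerD// normrM ler_wpM2l.
rewrite phi_lin// -dE (_ : _ - _ = a *: (A - phi f') + (B - phi g')).
  by apply: op_norm_leD => //; exact: op_norm_leZ.
by rewrite scalerBr opprD addrACA.
Qed.

Lemma closed_graph1 : closed_graph one idfun.
Proof. by rewrite -phi1; exact: closed_graph_phi. Qed.

Lemma closed_graph_norm f A (c : R[i]) : 0 <= c -> closed_graph f A ->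
  (forall x, `|f x| <= c) <-> op_norm_le A c.
Proof.
move=> c0 [_ _ h]; split=> [fc x|Ac x].
  apply: (@le_eps _ _ _ (2 * `|x|)); first by rewrite mulr_ge0.
  move=> e e0; have [g [Sg fg Ag]] := h _ e0.
  have gc : op_norm_le (phi g) (c + e).
    apply/embedding_norm => // [|y]; first by rewrite addr_ge0// ltW.
    rewrite (_ : g y = f y - (f y - g y)); last by rewrite subKr.
    by rewrite (le_trans (ler_normB _ _))// lerD.
  rewrite (_ : A x = (A - phi g) x + phi g x); last by rewrite !fctE subrK.
  rewrite (le_trans (ler_normD _ _))//.
  rewrite [leRHS](_ : _ = e * `|x| + (c + e) * `|x|); last by ring.
  by rewrite lerD.
apply: (@le_eps _ _ _ 2) => // e e0; have [g [Sg fg Ag]] := h _ e0.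
have gc y : `|g y| <= c + e.
  move: y; apply/embedding_norm => //; first by rewrite addr_ge0// ltW.
  rewrite (_ : phi g = A - (A - phi g)); last by rewrite subKr.
  exact: op_norm_leB.
rewrite (_ : f x = (f x - g x) + g x); last by rewrite subrK.
rewrite (le_trans (ler_normD _ _))//.
rewrite [leRHS](_ : _ = e + (c + e)); last by ring.
by rewrite lerD.
Qed.

Let closed_graphB f g A B : closed_graph f A -> closed_graph g B ->
  closed_graph (f - g) (A - B).
Proof.
move=> hf hg; have := closed_graph_linear (-1) hg hf.
by rewrite !scaleN1r addrC [- B + A]addrC.
Qed.

Lemma closed_graph_op_unique f A B : closed_graph f A -> closed_graph f B -> A = B.
Proof.
move=> hA hB; apply: subr0_eq; apply: (@op_norm_le0_eq _ _ _ _ 1) => // e e0.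
apply/(closed_graph_norm _ (closed_graphB hA hB)); first by rewrite mulr1 ltW.
by move=> x; rewrite !fctE subrr normr0 mulr1 ltW.
Qed.

Lemma closed_graph_fun_unique f g A : closed_graph f A -> closed_graph g A -> f = g.
Proof.
move=> hf hg; apply/funext => x; apply: subr0_eq; apply/eqP; rewrite -normr_le0.
apply: (closed_graph_norm _ (closed_graphB hf hg)).2 => // y.
by rewrite !fctE subrr normr0 mul0r.
Qed.

Lemma closed_graph_adjoint f A A' : closed_graph f A -> is_adjoint A A' ->
  closed_graph (fun x => (f x)^*) A'.
Proof.
move=> [cf bA h] adj; split.
- move=> x; apply/cvgrPdist_lt => e e0.
  have /cvgrPdist_lt/(_ _ e0) := cf x.
  by apply: filterS => y; rewrite -rmorphB/= norm_conjC.
- have [B adjB bB] := adjoint_exists bA.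
  by rewrite (adjoint_unique adj adjB).
move=> e e0; have [g [Sg fg Ag]] := h _ e0.
exists (fun x => (g x)^*); split=> [|x|]; first exact: S_conj.
  by rewrite -rmorphB/= norm_conjC.
apply: op_norm_le_adjoint (ltW e0) _ Ag.
by apply: adjointB => //; exact: embedding_adjoint.
Qed.

(** Approximants of a positive matrix need not be positive. Adding a small multiple of the unit
    repairs this; the repaired matrix has entries in [S], so [phi] carries its positivity across,
    and positivity survives the limit. *)
Lemma closed_graph_pos n (F : 'M[Cfun R X]_n) (P : 'M[H -> H]_n) :
  (forall i j, closed_graph (F i j) (P i j)) ->
  (forall i j, is_adjoint (P i j) (P j i)) ->
  fun_pos F <-> op_pos P.
Proof.
move=> FP adj.
have herm i j x : F j i x = (F i j x)^*.
  have := closed_graph_adjoint (FP i j) (adj i j).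
  by move=> /closed_graph_fun_unique/(_ (FP j i))<-.
have approx (e : R[i]) : 0 < e -> exists G : 'M[Cfun R X]_n,
  [/\ forall i j, S (G i j),
      forall i j x, G j i x = (G i j x)^*,
      forall i j x, `|F i j x - G i j x| <= e &
      forall i j, op_norm_le (P i j - phi (G i j)) e].
  move=> e0.
  have /choice[g hg] (ij : 'I_n * 'I_n) : exists g, [/\ S g,
      forall x, `|F ij.1 ij.2 x - g x| <= e & op_norm_le (P ij.1 ij.2 - phi g) e].
    by have [_ _ /(_ _ e0)] := FP ij.1 ij.2.
  have Sg i j : S (g (i, j)) by case: (hg (i, j)).
  (* Averaging with the conjugate of the transposed entry makes the approximant selfadjoint, as the
     perturbation lemmas require. *)
  pose G i j : Cfun R X := 2^-1 *: (g (i, j)) + 2^-1 *: (fun x => (g (j, i) x)^*).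
  have GE i j x : G i j x = 2^-1 * g (i, j) x + 2^-1 * (g (j, i) x)^* by [].
  have half (a b c d : R[i]) : `|a - c| <= e -> `|b - c| <= e ->
      d = 2^-1 * a + 2^-1 * b -> `|c - d| <= e.
    move=> ac bc ->; rewrite (_ : c - _ = 2^-1 * (c - a) + 2^-1 * (c - b)); last by field.
    rewrite (le_trans (ler_normD _ _))// !normrM ger0_norm ?invr_ge0// -mulrDr.
    by rewrite mulrC ler_pdivrMr// mulr_natr mulr2n lerD// distrC.
  exists (\matrix_(i, j) G i j); split=> [i j|i j x|i j x|i j].
  - by rewrite mxE; apply: S_linear => //; apply: SZ; exact: S_conj.
  - by rewrite !mxE !GE rmorphD !rmorphM/= conjCK fmorphV/= rmorph_nat addrC.
  - rewrite mxE; apply: half (GE i j x); first by case: (hg (i, j)) => _ + _; rewrite distrC.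
    by rewrite herm -rmorphB norm_conjC distrC; case: (hg (j, i)).
  rewrite mxE /G phi_lin; [|exact: Sg|by apply: SZ; exact: S_conj].
  rewrite phiZ; last exact: S_conj.
  rewrite (_ : _ - _ = 2^-1 *: (P i j - phi (g (i, j))) +
      2^-1 *: (P i j - phi (fun x => (g (j, i) x)^*))); last first.
    rewrite !scalerBr addrACA -scalerDl opprD.
    by rewrite -mulr2n -(mulr_natr 2^-1) mulVf ?pnatr_eq0// scale1r.
  rewrite (_ : e = `|2^-1| * e + `|2^-1| * e); last first.
    by rewrite ger0_norm ?invr_ge0//; field.
  apply: op_norm_leD; apply: op_norm_leZ; first by case: (hg (i, j)).
  apply: (op_norm_le_adjoint (ltW e0) (A := P j i - phi (g (j, i)))).
    by apply: adjointB => //; exact: embedding_adjoint.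
  by case: (hg (j, i)).
have Sshift (c : R[i]) (G : 'M[Cfun R X]_n) : (forall i j, S (G i j)) ->
    forall i j, S (shift_diag c one G i j).
  by move=> SG i j; rewrite mxE addrC; exact: S_linear.
have phi_shift (c : R[i]) (G : 'M[Cfun R X]_n) : (forall i j, S (G i j)) ->
    map_mx phi (shift_diag c one G) = shift_diag c idfun (map_mx phi G).
  move=> SG; apply/matrixP => i j; rewrite !mxE addrC phi_lin// phi1.
  by rewrite addrC.
have n0 : 0 < 1 + n%:R :> R[i] by rewrite ltr_wpDr.
(* With [d = e / (1 + n)], the approximation error [d] and the shift [d * n] add up to [e]. *)
have nE e : e / (1 + n%:R) + e / (1 + n%:R) * n%:R = e :> R[i].
  by field; exact/lt0r_neq0.
split=> pos.
  apply: op_pos_closed => e e0; have d0 := divr_gt0 e0 n0.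
  have [G [SG hermG FG PG]] := approx _ d0.
  exists (map_mx phi (shift_diag (e / (1 + n%:R) * n%:R) one G)).
    apply/phi_pos; first exact: Sshift.
    apply: fun_pos_perturb (ltW d0) pos _ _ => [i j x|i j x].
      by rewrite hermG herm rmorphB.
    by rewrite distrC.
  move=> i j; rewrite phi_shift// !mxE -[X in op_norm_le _ X]nE opprD addrA.
  apply: op_norm_leB; first exact: PG.
  case: ifP => _ x; rewrite !fctE normrZ; last by rewrite normr0 mul0r !mulr_ge0// ltW.
  by rewrite ger0_norm// mulr_ge0// ltW.
apply: fun_pos_closed => e e0; have d0 := divr_gt0 e0 n0.
have [G [SG hermG FG PG]] := approx _ d0.
exists (shift_diag (e / (1 + n%:R) * n%:R) one G).
  apply/phi_pos; first exact: Sshift.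
  rewrite phi_shift//; apply: op_pos_perturb (ltW d0) pos _ _ => i j.
    rewrite !mxE; apply: adjointB => //.
    rewrite (_ : G j i = fun x => (G i j x)^*); first exact: embedding_adjoint.
    by apply/funext => x; exact: hermG.
  by rewrite mxE; apply: op_norm_leBC; exact: PG.
move=> i j x; rewrite mxE -[leRHS]nE !fctE opprD addrA.
rewrite (le_trans (ler_normB _ _))// lerD//.
case: ifP => _; rewrite normrZ; last by rewrite normr0 mul0r mulr_ge0// ltW.
by rewrite normr1 mulr1 ger0_norm// mulr_ge0// ltW.
Qed.

End Extension.

(** * Closed systems and the minimality of their matrix order *)

Definition quad2 (R : realType) (H : hilbertSpace R) (P : 'M[H -> H]_2) (x y : H) :=
  hdot (P 0 0 x) x + hdot (P 0 1 y) x + (hdot (P 1 0 x) y + hdot (P 1 1 y) y).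

(* The last field is the 2 x 2 trace of minimality: the matrix order of a
   function system is determined by its compressions to scalar vectors. *)
Record closed_system (R : realType) (H : hilbertSpace R) (S : set (H -> H)) := ClosedSystem {
  cs_bounded : S `<=` bounded_operator H H;
  cs_linear : forall a A B, S A -> S B -> S (a *: A + B);
  cs_closed : op_closure S `<=` S;
  cs_adjoint : forall A B, S A -> is_adjoint A B -> S B;
  cs_one : S idfun;
  cs_min : forall P : 'M[H -> H]_2, (forall i j, S (P i j)) ->
    (forall i j, is_adjoint (P i j) (P j i)) ->
    (forall (a b : R[i]) h, 0 <= quad2 P (a *: h) (b *: h)) ->
    op_pos P }.

Section SpanClosure.
Context {R : realType}.
Implicit Types H K : hilbertSpace R.

Lemma span_ind (V : lmodType R[i]) (E : set V) (P : set V) :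
  P 0 -> (forall a u v, P u -> P v -> P (a *: u + v)) -> E `<=` P ->
  linear_span E `<=` P.
Proof. by move=> P0 Plin EP u; apply; split=> //; split. Qed.

Lemma op_closure_idem H K (S : set (H -> K)) :
  op_closure (op_closure S) `<=` op_closure S.
Proof.
move=> A [bA hA]; split=> // e e0; have e2 : 0 < e / 2 by rewrite divr_gt0.
have [B [bB hB] AB] := hA _ e2; have [C SC BC] := hB _ e2; exists C => //.
rewrite [e]splitr (_ : A - C = (A - B) + (B - C)); last by rewrite addrA subrK.
exact: op_norm_leD.
Qed.

Lemma op_closure_comp H K (S : set (H -> H)) (T : set (K -> K)) (m : H -> K) (n : K -> H) :
  bounded_operator H K m -> bounded_operator K H n ->
  (forall s, S s -> op_closure T (m \o s \o n)) ->
  forall s, op_closure S s -> op_closure T (m \o s \o n).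
Proof.
move=> bm bn h s [bs hs]; apply: op_closure_idem.
split; first by apply: bounded_comp => //; exact: bounded_comp.
move=> e e0; have [c c0 hc] := boundedP bm; have [d d0 hd] := boundedP bn.
have cd0 : 0 < c * d by rewrite mulr_gt0.
have [s' Ss' ss'] := hs (e / (c * d)) (divr_gt0 e0 cd0).
exists (m \o s' \o n); first exact: h.
rewrite (_ : _ - _ = m \o (s - s') \o n); last first.
  by apply/funext => x; rewrite /= !fctE /= (linB (bounded_lin bm)).
rewrite (_ : e = c * (e / (c * d)) * d); last by field; rewrite !gt_eqF.
apply: op_norm_le_comp => //; first by rewrite mulr_ge0 ?divr_ge0// ltW.
by apply: op_norm_le_comp => //; exact: ltW.
Qed.

End SpanClosure.

Section ClosedSystem.
Context {R : realType} {X : topologicalType} {S : set (Cfun R X)}.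
Context {H : hilbertSpace R} {phi : Cfun R X -> Bop H}.
Hypothesis cptX : compact [set: X].
Hypothesis fsS : function_system S.
Hypothesis hphi :
  unital_complete_order_embedding S (bounded_operator H H : set (Bop H)) phi.

Lemma closed_graph_pos1 (f : Cfun R X) (A : H -> H) :
  closed_graph (S := S) (phi := phi) f A -> is_adjoint A A ->
  (forall x, 0 <= f x) <-> (forall h, 0 <= hdot (A h) h).
Proof.
move=> fA adj.
have [h1 h2] : fun_pos (const_mx f : 'M[Cfun R X]_1) <-> op_pos (const_mx A : 'M[H -> H]_1).
  by apply: (closed_graph_pos cptX fsS hphi) => i j; rewrite !mxE.
split=> [f0|A0 x].
  have /h1/op_pos1 : fun_pos (const_mx f : 'M[Cfun R X]_1).
    by move=> x v; rewrite !big_ord1 mxE -mulrA -normCK mulr_ge0// exprn_ge0.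
  by move=> + h => /(_ h); rewrite mxE.
have /h2 : op_pos (const_mx A : 'M[H -> H]_1) by apply/op_pos1 => h; rewrite mxE.
by move=> /(_ x (fun=> 1)); rewrite !big_ord1 mxE rmorph1 !mulr1.
Qed.

Lemma closed_system_op_closure : closed_system (op_closure (phi @` S)).
Proof.
have total := closed_graph_onto cptX fsS hphi.
have toop f A : closed_graph (S := S) (phi := phi) f A -> op_closure (phi @` S) A.
  exact: closed_graph_op.
have lin := closed_graph_linear fsS hphi.
split=> [A []//|a A B /total[f fA] /total[g gB]||A B /total[f fA] AB||P SP adj Ppos].
- by apply: toop; exact: lin fA gB.
- exact: op_closure_idem.
- exact: toop (closed_graph_adjoint cptX fsS hphi fA AB).
- exact: toop (closed_graph1 fsS hphi).
have /choice[F hF] (ij : 'I_2 * 'I_2) := total _ (SP ij.1 ij.2).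
pose FF : 'M[Cfun R X]_2 := \matrix_(i, j) F (i, j).
have FP i j : closed_graph (S := S) (phi := phi) (FF i j) (P i j).
  by rewrite mxE; exact: hF.
apply/(closed_graph_pos cptX fsS hphi FP adj) => x v.
have e : lift ord0 ord0 = 1 :> 'I_2 by apply/val_inj.
rewrite !big_ord_recl !big_ord0 !addr0 !e.
pose c i j := v j * (v i)^*.
(* The last two summands cancel; with them the sum is built from the entries by
   [closed_graph_linear] alone. *)
pose f : Cfun R X := c 0 0 *: FF 0 0 + (c 0 1 *: FF 0 1 + (c 1 0 *: FF 1 0 +
  (c 1 1 *: FF 1 1 + (-1 *: FF 1 1 + FF 1 1)))).
pose A : H -> H := c 0 0 *: P 0 0 + (c 0 1 *: P 0 1 + (c 1 0 *: P 1 0 +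
  (c 1 1 *: P 1 1 + (-1 *: P 1 1 + P 1 1)))).
have fA : closed_graph (S := S) (phi := phi) f A by do 5!(refine (lin _ _ _ _ _ (FP _ _) _)); exact: FP.
have AE y z : hdot (A y) z = c 0 0 * hdot (P 0 0 y) z + (c 0 1 * hdot (P 0 1 y) z +
    (c 1 0 * hdot (P 1 0 y) z + c 1 1 * hdot (P 1 1 y) z)).
  by rewrite /A !fctE !dotDl !dotZl; ring.
have Aadj : is_adjoint A A.
  move=> y z; rewrite [RHS]dotC !AE /c.
  rewrite (adj 0 0) (adj 0 1) (adj 1 0) (adj 1 1) !rmorphD !rmorphM/= !conjCK.
  by rewrite -!dotC; ring.
have : forall x, 0 <= f x.
  (* The form of [A] at [h] is the form of [P] at [(v 0 *: h, v 1 *: h)], a compression to a scalar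
     vector. *)
  apply/(closed_graph_pos1 fA Aadj) => h.
  have := Ppos (v 0) (v 1) h; rewrite /quad2 AE /c.
  have lP i j : linear (P i j) by exact: bounded_lin (SP i j).1.
  by rewrite !(linZ (lP _ _)) !dotZl !dotZr; congr (0 <= _); ring.
move/(_ x).
by rewrite /f /c !fctE /GRing.scale/=; congr (0 <= _); ring.
Qed.

End ClosedSystem.

(** * Intertwiners of a TRO equivalence *)

(** By log-convexity the ratios of consecutive terms never decrease, so a first ratio above [c]
    makes [a] outgrow every multiple of [c ^+ j]. Bernoulli's inequality makes this quantitative. *)
Lemma logconvex_growth (R : realType) (a : nat -> R) (C c : R) :
  (forall j, 0 <= a j) -> (forall j, a j.+1 ^+ 2 <= a j * a j.+2) -> 0 <= c ->
  (forall j, a j <= C * c ^+ j) -> a 1%N <= c * a 0%N.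
Proof.
move=> a_ge0 conv c0 bound; rewrite leNgt; apply/negP => lt1.
have a1 : 0 < a 1%N by rewrite (le_lt_trans _ lt1)// mulr_ge0.
have a0 : 0 < a 0%N.
  rewrite lt_neqAle a_ge0 andbT; apply/eqP => a00.
  by have := conv 0%N; rewrite -a00 mul0r leNgt exprn_gt0.
pose r := a 1%N / a 0%N.
have rc : c < r by rewrite /r ltr_pdivlMr.
have r0 : 0 < r by rewrite (le_lt_trans c0 rc).
have step j : 0 < a j /\ r * a j <= a j.+1.
  elim: j => [|j [aj raj]]; first by rewrite /r divfK ?gt_eqF.
  have aj1 : 0 < a j.+1 by rewrite (lt_le_trans _ raj)// mulr_gt0.
  split=> //; rewrite -(ler_pM2l aj) mulrCA (le_trans _ (conv j))//.
  by rewrite mulrA expr2 ler_wpM2r// ltW.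
have geo j : r ^+ j * a 0%N <= a j.
  elim: j => [|j IH]; first by rewrite expr0 mul1r.
  by rewrite exprS -mulrA (le_trans _ (step j).2)// ler_wpM2l// ltW.
move: c0; rewrite le_eqVlt => /predU1P[c0|c0].
  have := bound 1%N; rewrite -c0 expr1 mulr0 leNgt.
  by rewrite a1.
pose eta := r / c - 1.
have eta0 : 0 < eta by rewrite subr_gt0 ltr_pdivlMr// mul1r.
have bern j : 1 + j%:R * eta <= (r / c) ^+ j.
  have -> : r / c = 1 + eta by rewrite addrC subrK.
  elim: j => [|j IH]; first by rewrite mul0r addr0 expr0.
  have e1 : 0 <= 1 + eta by rewrite addr_ge0// ltW.
  rewrite exprS (le_trans _ (ler_wpM2l e1 IH))// -subr_ge0.
  rewrite (_ : _ - _ = j%:R * eta ^+ 2); last by rewrite -natr1; ring.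
  by rewrite mulr_ge0// exprn_ge0// ltW.
have lim j : j%:R <= C / (a 0%N * eta).
  rewrite ler_pdivlMr ?mulr_gt0// mulrCA.
  have h := le_trans (geo j) (bound j).
  have : a 0%N * (r / c) ^+ j <= C.
    by rewrite expr_div_n mulrA ler_pdivrMr ?exprn_gt0// mulrC.
  apply: le_trans; rewrite ler_wpM2l ?a_ge0// (le_trans _ (bern j))//.
  by rewrite lerDr.
have [j hj] : exists j : nat, C / (a 0%N * eta) < j%:R.
  exists (Num.bound (C / (a 0%N * eta))); rewrite archi_boundP//.
  exact: le_trans (lim 0%N).
by have := lt_le_trans hj (lim j); rewrite ltxx.
Qed.

(** What a TRO equivalence says about the closures, in a form that is stable under exchanging M with
    its adjoint, so that each result serves in both directions. *)
Record morita (R : realType) (H K : hilbertSpace R) (S : set (H -> H))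
    (T : set (K -> K)) (M : set (H -> K)) := Morita {
  mo_source : closed_system S;
  mo_target : closed_system T;
  mo_bounded : M `<=` bounded_operator H K;
  mo_linear : forall a m n, M m -> M n -> M (a *: m + n);
  mo_pull : forall m m' n t, M m -> is_adjoint m m' -> M n -> T t ->
    S (m' \o t \o n);
  mo_push : forall m n n' s, M m -> M n -> is_adjoint n n' -> S s ->
    T (m \o s \o n');
  mo_nondeg_source : closed_span (product_set (adjoint_set M) M) idfun;
  mo_nondeg_target : closed_span (product_set M (adjoint_set M)) idfun }.

(** The second equation is the first one for the adjoint of M with [s] and [t] exchanged; keeping
    both makes the relation symmetric. *)
Definition intertwine (R : realType) (H K : hilbertSpace R) (M : set (H -> K))
    (s : H -> H) (t : K -> K) : Prop :=
  forall m m', M m -> is_adjoint m m' ->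
    (forall h, t (m h) = m (s h)) /\ (forall k, s (m' k) = m' (t k)).

Section MoritaSym.
Context {R : realType} {H K : hilbertSpace R}.

Lemma adjoint_setK (M : set (H -> K)) : M `<=` bounded_operator H K ->
  adjoint_set (adjoint_set M) = M.
Proof.
move=> bM; apply/seteqP; split=> [m [m' [n Mn nm'] m'm]|m Mm].
  by rewrite (adjoint_unique m'm (adjoint_sym nm')).
have [m' mm' _] := adjoint_exists (bM _ Mm).
by exists m'; [exists m|exact: adjoint_sym].
Qed.

Lemma adjoint_bounded (A : H -> K) B :
  bounded_operator H K A -> is_adjoint A B -> bounded_operator K H B.
Proof.
by move=> /adjoint_exists[C hC bC] hB; rewrite (adjoint_unique hB hC).
Qed.

Lemma morita_sym (S : set (H -> H)) (T : set (K -> K)) (M : set (H -> K)) :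
  morita S T M -> morita T S (adjoint_set M).
Proof.
case=> cS cT bM lM pull push nS nT; split=> //.
- by move=> B [A /bM bA AB]; exact: adjoint_bounded AB.
- move=> a m' n' [m Mm mm'] [n Mn nn']; exists (a^* *: m + n); first exact: lM.
  by have := adjoint_add a^* mm' nn'; rewrite conjCK.
- move=> m1 m2 n s [m Mm mm1] m12 [n' Mn' nn'] Ss.
  by rewrite -(adjoint_unique (adjoint_sym mm1) m12); exact: push nn' Ss.
- move=> m' n' n t [m Mm mm'] [n1 Mn1 nn'] n'n Tt.
  by rewrite -(adjoint_unique (adjoint_sym nn') n'n); exact: pull mm' Mn1 Tt.
- by rewrite adjoint_setK.
- by rewrite adjoint_setK.
Qed.

End MoritaSym.

Section Morita.
Context {R : realType} {H K : hilbertSpace R} {S : set (H -> H)}.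
Context {T : set (K -> K)} {M : set (H -> K)} (mo : morita S T M).

Let cS := mo_source mo.
Let cT := mo_target mo.
Let bM m : M m -> bounded_operator H K m. Proof. exact: (mo_bounded mo). Qed.
Let lM m : M m -> linear m. Proof. by move=> Mm; exact: bounded_lin (bM Mm). Qed.
Let lS s : S s -> linear s. Proof. by move=> Ss; exact: bounded_lin (cs_bounded cS Ss). Qed.
Let lT t : T t -> linear t. Proof. by move=> Tt; exact: bounded_lin (cs_bounded cT Tt). Qed.

Let S0 : S 0.
Proof.
by have := cs_linear cS (-1) (cs_one cS) (cs_one cS); rewrite scaleN1r addNr.
Qed.

Let T0 : T 0.
Proof.
by have := cs_linear cT (-1) (cs_one cT) (cs_one cT); rewrite scaleN1r addNr.
Qed.

Let bM' m m' : M m -> is_adjoint m m' -> bounded_operator K H m'.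
Proof. by move=> Mm mm'; exact: adjoint_bounded (bM Mm) mm'. Qed.

(** [S] need not be closed under products, but it absorbs [m' \o n]: for [u] close to 1 in the span
    of the [p' \o q], the operator [u s m' n] is a combination of terms [p' (q s m') n], which
    [mo_push] and [mo_pull] place in [S]. *)
Let mulS s m m' n : S s -> M m -> is_adjoint m m' -> M n -> S (s \o (m' \o n)).
Proof.
move=> Ss Mm mm' Mn; apply: (cs_closed cS).
have [_ nd] := mo_nondeg_source mo.
have bw : bounded_operator H H (s \o (m' \o n)).
  apply: bounded_comp (cs_bounded cS Ss) _; apply: bounded_comp (bM Mn).
  exact: bM' mm'.
have [c c0 hc] := boundedP bw.
split=> // e e0; have [u Eu hu] := nd (e / c) (divr_gt0 e0 c0).
exists (u \o (s \o (m' \o n))).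
  pose P := [set u : H -> H | S (u \o (s \o (m' \o n)))].
  suff : P u by [].
  apply: span_ind Eu; first exact: S0.
    by move=> a v w Sv Sw; exact: (cs_linear cS _ Sv Sw).
  move=> _ [p' [q [[p Mp pp'] Mq ->]]] /=.
  exact: (mo_pull mo Mp pp' Mn (mo_push mo Mq Mm mm' Ss)).
rewrite (_ : e = e / c * c); last by field; rewrite gt_eqF.
move=> x; have := op_norm_le_comp _ hu hc x; apply.
by rewrite divr_ge0// ltW.
Qed.

(* The matrix ((s, a s), (s a, a s a)), a = m^* m, is the transpose of the
   positive matrix (1, a)^* s (1, a). *)
Let quad_pos p m m' : S p -> is_adjoint p p -> (forall h, 0 <= hdot (p h) h) ->
  M m -> is_adjoint m m' -> forall x y,
  0 <= hdot (p x) x + hdot (p y) (m' (m x)) +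
    (hdot (p (m' (m x))) y + hdot (p (m' (m y))) (m' (m y))).
Proof.
move=> Sp adjp ppos Mm mm' x y; pose a := m' \o m.
have adja : is_adjoint a a by exact: adjoint_comp (adjoint_sym mm') mm'.
have adjE u v : hdot u (m' (m v)) = hdot (m' (m u)) v by rewrite (adja u v).
have lm := lM Mm; have lm' := bounded_lin (bM' Mm mm').
have Spa : S (p \o a) by exact: (mulS Sp Mm mm' Mm).
have adjpa : is_adjoint (p \o a) (a \o p) by exact: adjoint_comp.
have Sap : S (a \o p) by exact: (cs_adjoint cS Spa adjpa).
have Sapa : S (a \o p \o a).
  exact: (mo_pull mo Mm mm' Mm (mo_push mo Mm Mm mm' Sp)).
pose P : 'M[H -> H]_2 := block2 p (a \o p) (p \o a).
pose Q : 'M[H -> H]_2 := \matrix_(i, j)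
  if i == 0 then (if j == 0 then p else a \o p)
  else (if j == 0 then p \o a else a \o p \o a).
have : op_pos Q.
  apply: (cs_min cS) => [i j|i j|b c h].
  - by rewrite mxE; do 2!case: ifP.
  - rewrite !mxE; case: (i == 0); case: (j == 0) => //.
      exact: adjoint_sym adjpa.
    exact: adjoint_comp (adjoint_sym adjpa) adja.
  rewrite /quad2 !mxE/= /a/= !(linZ (lS Sp), linZ lm, linZ lm') !dotZl !dotZr.
  (* Transposition conjugates the scalars: the compression of [Q] to [(b, c)] is the form of [p] at
     [b^* h + c^* a h]. *)
  have := ppos (b^* *: h + c^* *: m' (m h)).
  rewrite (linD (lS Sp)) !(linZ (lS Sp)) !dotDl !dotDr !dotZl !dotZr !conjCK.
  by rewrite !adjE; congr (0 <= _); ring.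
by move=> /op_pos2/(_ x y); rewrite !mxE/= /a/= !adjE.
Qed.

Lemma morita_commute_sa s m m' : S s -> is_adjoint s s -> M m -> is_adjoint m m' ->
  forall h, m' (m (s h)) = s (m' (m h)).
Proof.
move=> Ss adjs Mm mm' h; pose a := m' \o m.
have adja : is_adjoint a a by exact: adjoint_comp (adjoint_sym mm') mm'.
have la : linear a by exact: linear_comp (bounded_lin (bM' Mm mm')) (lM Mm).
have ls := lS Ss.
have [c c0 hc] := boundedP (cs_bounded cS Ss).
have sre x : hdot (s x) x \is Num.real.
  by apply/CrealP; rewrite -dotC adjs.
have sle x : `|hdot (s x) x| <= c * hdot x x.
  by rewrite norm_dot expr2 mulrA (le_trans (dot_norm_le _ _))// ler_wpM2r.
have pos x : 0 <= hdot ((c *: idfun + s) x) x.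
  rewrite !fctE dotDl dotZl -lerBlDr sub0r.
  by rewrite (le_trans _ (sle x))// (le_trans (real_ler_norm _))// ?rpredN// normrN.
have neg x : 0 <= hdot ((c *: idfun - s) x) x.
  rewrite !fctE dotBl dotZl subr_ge0.
  by rewrite (le_trans _ (sle x))// real_ler_norm.
have cre : c^* = c by rewrite geC0_conj// ltW.
have Scs : S (c *: idfun + s) by exact: (cs_linear cS _ (cs_one cS) Ss).
have SsN : S (- s).
  by rewrite -[- s]addr0 -scaleN1r; exact: (cs_linear cS _ Ss S0).
have ScN : S (c *: idfun - s) by exact: (cs_linear cS _ (cs_one cS) SsN).
have adjcs : is_adjoint (c *: idfun + s) (c *: idfun + s).
  by have := adjoint_add c (@adjoint_id _ H) adjs; rewrite cre.
have adjcN : is_adjoint (c *: idfun - s) (c *: idfun - s).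
  move=> x y; rewrite !fctE dotBl dotBr dotZl dotZr cre adjs; done.
have [k kE] : exists k, k = m' (m (s h)) - s (m' (m h)) by eexists.
suff : k = 0 by rewrite kE => /subr0_eq.
apply/eqP; rewrite -normr_eq0 -sqrf_eq0 eq_le exprn_ge0// andbT.
have lm := lM Mm; have lm' := bounded_lin (bM' Mm mm').
have adjE u v : hdot u (m' (m v)) = hdot (m' (m u)) v by rewrite (adja u v).
have : 4 * `|k| ^+ 2 <= 0.
  apply: (@small_slope _ (2 * (c * `|k| ^+ 2))).
    by rewrite !mulr_ge0 ?exprn_ge0// ltW.
  move=> t t0.
  (* At [(- a h + w, h)] the scalar [c] contributes exactly [c |w|^2], and [s] contributes
     [2 Re <k, w>] to first order. Taking [w = - t k] for [c + s] and [w = t k] for [c - s], the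
     constant and quadratic terms of [s] cancel in the sum, which leaves
     [2 c t^2 |k|^2 - 4 t |k|^2]. *)
  have p1 := quad_pos Scs adjcs pos Mm mm' (- m' (m h) + - t *: k) h.
  have p2 := quad_pos ScN adjcN neg Mm mm' (- m' (m h) + t *: k) h.
  have := addr_ge0 p1 p2; rewrite -subr_ge0.
  have tre : t^* = t by rewrite geC0_conj// ltW.
  have tNre : (- t)^* = - t by rewrite rmorphN/= tre.
  have e1 : hdot (m' (m (s k))) h = hdot k (s (m' (m h))) by rewrite -adjE adjs.
  have e2 : hdot (s (m' (m k))) h = hdot k (m' (m (s h))) by rewrite adjs -adjE.
  have e3 : hdot (m' (m (s h))) k = `|k| ^+ 2 + hdot (s (m' (m h))) k.
    by rewrite -norm_dot {2}kE dotBl subrK.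
  have e4 : hdot k (m' (m (s h))) = `|k| ^+ 2 + hdot k (s (m' (m h))).
    by rewrite -norm_dot {3}kE dotBr subrK.
  rewrite !fctE/= !(linD lm, linD lm', linD ls, linN lm, linN lm', linN ls,
    linZ lm, linZ lm', linZ ls).
  rewrite !(dotDl, dotDr, dotNl, dotNr, dotZl, dotZr) tre tNre.
  rewrite !adjE e1 e2 e3 e4 !norm_dot.
  by congr (0 <= _); ring.
by rewrite pmulr_rle0.
Qed.

Lemma morita_commute_diag s m m' : S s -> M m -> is_adjoint m m' ->
  forall h, m' (m (s h)) = s (m' (m h)).
Proof.
move=> Ss Mm mm' h.
have [s' ss' _] := adjoint_exists (cs_bounded cS Ss).
have Ss' : S s' by exact: (cs_adjoint cS Ss ss').
have lm := lM Mm; have lm' := bounded_lin (bM' Mm mm').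
have S_D u v : S u -> S v -> S (u + v).
  by move=> Su Sv; rewrite -[u]scale1r; exact: (cs_linear cS _ Su Sv).
have SZ a u : S u -> S (a *: u).
  by move=> Su; rewrite -[_ *: _]addr0; exact: (cs_linear cS _ Su S0).
pose s1 := s + s'; pose s2 := 'i *: s + - 'i *: s'.
have adj1 : is_adjoint s1 s1.
  by move=> x y; rewrite /s1 !fctE dotDl dotDr ss' (adjoint_sym ss') addrC.
have adj2 : is_adjoint s2 s2.
  move=> x y; rewrite /s2 !fctE dotDl dotDr !dotZl !dotZr ss' (adjoint_sym ss').
  by rewrite rmorphN/= conjCi opprK addrC.
have c1 := morita_commute_sa (S_D _ _ Ss Ss') adj1 Mm mm' h.
have c2 := morita_commute_sa (S_D _ _ (SZ 'i _ Ss) (SZ (- 'i) _ Ss')) adj2 Mm mm' h.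
move: c1 c2; rewrite /s1 /s2 !fctE.
rewrite !(linD lm, linD lm', linZ lm, linZ lm').
set u := m' (m (s h)); set v := m' (m (s' h)); set w := s (m' (m h)).
set z := s' (m' (m h)) => c1 c2.
have {}c2 : u - v = w - z.
  apply: (scalerI (neq0Ci R[i])); rewrite !scalerBr.
  by rewrite -!scaleNr.
apply: (@scalerI _ H 2); first by rewrite pnatr_eq0.
rewrite !scaler_nat !mulr2n.
have -> : u + u = (u + v) + (u - v) by rewrite addrACA subrr addr0.
by rewrite c1 c2 addrACA subrr addr0.
Qed.

(** Polarisation: the diagonal case for [a *: m + n], with [a = 1] and [a = 'i], separates the two
    mixed terms. *)
Lemma morita_commute s m m' n : S s -> M m -> is_adjoint m m' -> M n ->
  forall h, m' (n (s h)) = s (m' (n h)).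
Proof.
move=> Ss Mm mm' Mn h; have [n' nn' _] := adjoint_exists (bM Mn).
have lm := lM Mm; have lm' := bounded_lin (bM' Mm mm'); have ls := lS Ss.
have ln := lM Mn; have ln' := bounded_lin (bM' Mn nn').
pose F (q' : K -> H) (q : H -> K) := q' (q (s h)) - s (q' (q h)).
have F0 p p' : M p -> is_adjoint p p' -> F p' p = 0.
  by move=> Mp pp'; rewrite /F (morita_commute_diag Ss Mp pp') subrr.
have key a : a *: F n' m + a^* *: F m' n = 0.
  have Mp := mo_linear mo a Mm Mn.
  have := F0 _ _ Mp (adjoint_add a mm' nn').
  rewrite /F !fctE.
  rewrite !(linD lm', linD ln', linD ls, linZ lm', linZ ln', linZ ls).
  have := F0 _ _ Mm mm'; have := F0 _ _ Mn nn'.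
  rewrite /F => /subr0_eq -> /subr0_eq ->.
  set P := s (m' (m h)); set Q := s (n' (n h)).
  have zmodE (x b c y d e : H) :
      x + b + (c + y) - (x + d + (e + y)) = (c - e) + (b - d).
    rewrite (addrC x b) (addrC x d) (addrACA b x) (addrACA d x).
    by rewrite opprD (addrACA (b + c)) subrr addr0 opprD (addrACA b) addrC.
  by move=> E; rewrite -[RHS]E !scalerBr !scalerDr zmodE.
have k1 := key 1; have ki := key 'i.
apply: subr0_eq; rewrite -/(F m' n).
move: k1 ki; rewrite rmorph1 !scale1r conjCi => k1.
have -> : F n' m = - F m' n by apply/eqP; rewrite -addr_eq0 k1.
rewrite scalerN scaleNr -opprD -scalerDr => /eqP; rewrite oppr_eq0 scaler_eq0 (negPf (neq0Ci _))/=.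
by rewrite -mulr2n -scaler_nat scaler_eq0 pnatr_eq0 => /eqP.
Qed.

(* For u in the span of M M^*, t is the image of u under m n^* |-> m s n^*, that
   is, u times the intertwiner of s still to be built.  The last clause,
   t' u = u' t, is what bounds t in terms of u. *)
Let pre (s : H -> H) (u t : K -> K) : Prop :=
  [/\ bounded_operator K K u, T t,
      forall m, M m -> forall h, t (m h) = u (m (s h)),
      forall m m', M m -> is_adjoint m m' -> forall k, m' (t k) = s (m' (u k)) &
      forall u' t', bounded_operator K K u' -> T t' ->
        (forall m, M m -> forall h, t' (m h) = u' (m (s h))) ->
        forall k, t' (u k) = u' (t k)].

Let pre_linear s a u v t w : S s -> pre s u t -> pre s v w ->
  pre s (a *: u + v) (a *: t + w).
Proof.
move=> Ss [bu Tt ut tu tu'] [bv Tw vw wv wv']; have ls := lS Ss.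
split=> [|||m m' Mm mm' k|u' t' bu' Tt' h' k].
- exact: bounded_add.
- exact: (cs_linear cT).
- by move=> m Mm h; rewrite !fctE ut// vw.
- have lm' := bounded_lin (bM' Mm mm').
  rewrite !fctE (linD lm') (linZ lm') (tu _ _ Mm mm') (wv _ _ Mm mm').
  by rewrite (linD lm') (linZ lm') (linD ls) (linZ ls).
have lu' := bounded_lin bu'; have lt' := lT Tt'.
by rewrite !fctE (linD lt') (linZ lt') (linD lu') (linZ lu') (tu' u' t')// (wv' u' t').
Qed.

Let pre_ex s u : S s -> linear_span (product_set M (adjoint_set M)) u ->
  exists t, pre s u t.
Proof.
move=> Ss Eu; pose P := [set u | exists t, pre s u t]; suff : P u by [].
have ls := lS Ss.
apply: span_ind Eu => [|a v w [t vt] [t' wt']|_ [m [n' [Mm [n Mn nn'] ->]]]].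
- exists 0; split=> //; first exact: bounded0.
  + move=> m m' Mm mm' k; have lm' := bounded_lin (bM' Mm mm').
    by rewrite [LHS](lin0 lm') [X in s X](lin0 lm') (lin0 ls).
  + move=> u' t' bu' Tt' _ k.
    by rewrite [LHS](lin0 (lT Tt')) [RHS](lin0 (bounded_lin bu')).
- by exists (a *: t + t'); exact: pre_linear.
have bn' := bM' Mn nn'.
exists (m \o s \o n'); split.
- by apply: bounded_comp bn'; exact: bM.
- exact: (mo_push mo Mm Mn nn' Ss).
- by move=> p Mp h /=; rewrite (morita_commute Ss Mn nn' Mp).
- by move=> p p' Mp pp' k /=; rewrite (morita_commute Ss Mp pp' Mm).
by move=> u' t' bu' Tt' h k /=; exact: h.
Qed.

(** Norms are present only through their upper bounds, so the term [c / 2] cannot be absorbed by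
    subtraction. Iterating the improvement gives the bounds [c / 2 ^+ k + 2 * d] instead. *)
Let halving (t : K -> K) (d : R[i]) : 0 <= d -> (exists2 c, 0 <= c & op_norm_le t c) ->
  (forall c, 0 <= c -> op_norm_le t c -> op_norm_le t (c / 2 + d)) ->
  op_norm_le t (2 * d).
Proof.
move=> d0 [c c0 hc] half.
have it k : op_norm_le t (c / 2 ^+ k + 2 * d).
  elim: k => [|k IH].
    by apply: op_norm_leW hc _; rewrite expr0 divr1 lerDl mulr_ge0.
  have := half _ _ IH.
  rewrite (_ : _ / 2 + d = c / 2 ^+ k.+1 + 2 * d); last first.
    by rewrite exprS; field; rewrite expf_neq0// pnatr_eq0.
  by apply; rewrite addr_ge0 ?mulr_ge0// invr_ge0 exprn_ge0.
move=> y; apply: (@le_eps _ _ _ (c * `|y|)); first by rewrite mulr_ge0.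
move=> e /invS_small[k /ltW hk].
rewrite (le_trans (it k y))// mulrDl addrC lerD2l mulrA ler_wpM2r// mulrC ler_wpM2r//.
apply: le_trans hk; rewrite -exprVn exprVn /invS lef_pV2 ?posrE ?ltr0n ?exprn_gt0//.
by rewrite -natrX ler_nat ltn_expl.
Qed.

Lemma intertwine_exists s : S s -> exists2 t, T t & intertwine M s t.
Proof.
move=> Ss; have ls := lS Ss; have [_ nd] := mo_nondeg_target mo.
(* A fixed approximate unit: its partner [t0] provides the constant [b], and 1/2 is the factor that
   [halving] absorbs. *)
have [u0 Eu0 hu0] := nd (1 / 2) (divr_gt0 ltr01 (ltr0Sn _ 1)).
have [t0 [bu0 Tt0 _ _ hut0]] := pre_ex Ss Eu0.
have [b b0 hb] := boundedP (cs_bounded cT Tt0).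
have bound u t c : pre s u t -> 0 <= c -> op_norm_le u c -> op_norm_le t (2 * (c * b)).
  move=> [bu Tt ut _ _] c0 hc.
  apply: halving => [||C C0 hC y].
  - by rewrite mulr_ge0// ltW.
  - by have [C /ltW C0 hC] := boundedP (cs_bounded cT Tt); exists C.
  (* The exchange [t u0 = u t0] replaces [t (u0 y)], on which nothing is known, by a vector of norm
     at most [c * b * |y|]. *)
  rewrite (_ : t y = t ((idfun - u0) y) + u (t0 y)); last first.
    rewrite -(hut0 u t)// -(linD (lT Tt)) !fctE.
    by rewrite subrK.
  rewrite (le_trans (ler_normD _ _))// mulrDl lerD//.
    rewrite (le_trans (hC _))// -mulrA ler_wpM2l//.
    by have := hu0 y; rewrite mul1r.
  by rewrite (le_trans (hc _))// -mulrA ler_wpM2l.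
(* Dividing by [2 * b] cancels the constant in [bound], so that the [t k] get the rate which
   [op_complete] expects. *)
have d0 k : 0 < invS k / (2 * b) :> R[i] by rewrite divr_gt0 ?invS_gt0// mulr_gt0.
have /choice[u hu] k : exists u, exists2 t, pre s u t & op_norm_le (idfun - u) (invS k / (2 * b)).
  have [u Eu hu] := nd _ (d0 k); have [t ut] := pre_ex Ss Eu.
  by exists u, t.
have /choice[t ht] k : exists t, pre s (u k) t /\ op_norm_le (idfun - u k) (invS k / (2 * b)).
  by have [t ut hk] := hu k; exists t.
have ut k : pre s (u k) (t k) by case: (ht k).
have uk k : op_norm_le (idfun - u k) (invS k / (2 * b)) by case: (ht k).
have [k|k l|t1 bt1 ht1] := op_complete (A := t).
- by apply: (cs_bounded cT); case: (ut k).
- have ukl : pre s (u k - u l) (t k - t l).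
    have := pre_linear (-1) Ss (ut l) (ut k).
    by rewrite !scaleN1r addrC [- t l + _]addrC.
  have ukl' : op_norm_le (u k - u l) (invS k / (2 * b) + invS l / (2 * b)).
    rewrite [X in op_norm_le _ X]addrC (_ : u k - u l = (idfun - u l) - (idfun - u k)).
      exact: op_norm_leB.
    by rewrite opprB [RHS]addrC addrA subrK.
  have := bound _ _ _ ukl _ ukl'; rewrite (_ : 2 * (_ * b) = invS k + invS l).
    by apply; rewrite addr_ge0// ltW.
  by field; rewrite gt_eqF.
have Tt1 : T t1.
  apply: (cs_closed cT); split=> // e /invS_small[k /ltW hk]; exists (t k).
    by case: (ut k).
  by apply: op_norm_leBC; exact: op_norm_leW (ht1 k) hk.
have [c c0 hc] := boundedP (cs_bounded cS Ss).
exists t1 => // m m' Mm mm'; split=> [h|h].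
  apply: subr0_eq; apply/eqP; rewrite -normr_le0.
  apply: (@le_eps _ _ _ (`|m h| + (2 * b)^-1 * `|m (s h)|)).
    by rewrite addr_ge0// mulr_ge0// invr_ge0 mulr_ge0// ltW.
  move=> e /invS_small[k /ltW hk]; rewrite add0r.
  apply: le_trans (ler_wpM2r _ hk); last first.
    by rewrite addr_ge0// mulr_ge0// invr_ge0 mulr_ge0// ltW.
  have [_ _ utk _ _] := ut k.
  rewrite (_ : _ - _ = - ((t k - t1) (m h)) - (idfun - u k) (m (s h))); last first.
    by rewrite !fctE utk// opprB opprB -addrA [X in _ = _ + X]addrA addNr sub0r.
  rewrite (le_trans (ler_normB _ _))// mulrDr normrN lerD//; first exact: ht1.
  by have := uk k (m (s h)); rewrite mulrA.
have lm' := bounded_lin (bM' Mm mm').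
have [d d1 hd] := boundedP (bM' Mm mm').
apply: subr0_eq; apply/eqP; rewrite -normr_le0.
pose C := c * (d * ((2 * b)^-1 * `|h|)) + d * `|h|.
have C0 : 0 <= C.
  have b2 : 0 <= (2 * b)^-1 by rewrite invr_ge0 mulr_ge0// ltW.
  by apply: addr_ge0; rewrite !mulr_ge0 ?(ltW c0) ?(ltW d1).
apply: (@le_eps _ _ _ C) => // e /invS_small[k /ltW hk]; rewrite add0r.
apply: le_trans (ler_wpM2r C0 hk).
have [_ _ _ tuk _] := ut k.
rewrite (_ : _ - _ = s (m' ((idfun - u k) h)) + m' ((t k - t1) h)); last first.
  rewrite !fctE !(linB lm') (linB ls) (tuk _ _ Mm mm').
  by rewrite addrA subrK.
rewrite (le_trans (ler_normD _ _))// /C mulrDr lerD//.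
  rewrite (le_trans (hc _))// mulrCA ler_wpM2l ?(ltW c0)//.
  rewrite (le_trans (hd _))// mulrCA ler_wpM2l ?(ltW d1)//.
  by have := uk k h; rewrite mulrA.
rewrite (le_trans (hd _))// mulrCA ler_wpM2l ?(ltW d1)//.
exact: ht1.
Qed.

(** Every [m'] takes the same values on [t k] and on [t' k]. Hence each [u] in the span of M M^*
    annihilates [t - t'], and such [u] approximate 1. *)
Lemma intertwine_selfadjoint s t : is_adjoint s s -> T t -> intertwine M s t ->
  is_adjoint t t.
Proof.
move=> adjs Tt st; have [t' tt' _] := adjoint_exists (cs_bounded cT Tt).
have Tt' : T t' by exact: (cs_adjoint cT Tt tt').
have ker m m' : M m -> is_adjoint m m' -> forall k, m' (t' k) = m' (t k).
  move=> Mm mm' k; apply: dot_inj2 => h; rewrite -(st _ _ Mm mm').2.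
  rewrite (adjoint_sym mm') (adjoint_sym tt') (st _ _ Mm mm').1 adjs.
  by rewrite (adjoint_sym mm').
have [_ nd] := mo_nondeg_target mo.
suff e : t = t' by rewrite {2}e.
apply/subr0_eq; have [c /ltW c0 hc] := boundedP (cs_bounded cT Tt).
have bD : bounded_operator K K (t - t').
  by apply: bounded_sub; apply: (cs_bounded cT).
have [d /ltW d0 hd] := boundedP bD.
apply: (op_norm_le0_eq d0) => e e0; have [u Eu hu] := nd _ e0.
suff uD : u \o (t - t') = 0.
  rewrite (_ : t - t' = (idfun - u) \o (t - t')).
    by move=> k; have := op_norm_le_comp (ltW e0) hu hd k.
  apply/funext => k.
  by rewrite -[RHS]/((t - t') k - (u \o (t - t')) k) uD; exact/esym/subr0.
pose P := [set u : K -> K | u \o (t - t') = 0]; suff : P u by [].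
apply: span_ind Eu => [|a v w vD wD|_ [m [n' [Mm [n Mn nn'] ->]]]] //.
  apply/funext => k; rewrite /= !fctE.
  have /(congr1 (fun f => f k)) /= -> := vD.
  have /(congr1 (fun f => f k)) /= -> := wD.
  by rewrite [LHS]addr0; exact: scaler0.
apply/funext => k /=; rewrite !fctE (linB (bounded_lin (bM' Mn nn'))).
by rewrite (ker _ _ Mn nn') subrr; exact: lin0 (lM Mm).
Qed.

(** On vectors [u k] with [u] in the span of M M^*, the iterates of [t] grow at most like [c ^+ j],
    up to a constant depending on [u] and [k]. Log-convexity removes that constant, and such vectors
    approximate every vector. *)
Lemma intertwine_norm s t (c : R[i]) : S s -> T t -> is_adjoint s s ->
  intertwine M s t -> 0 <= c -> op_norm_le s c -> op_norm_le t c.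
Proof.
move=> Ss Tt adjs st c0 hs; have adjt := intertwine_selfadjoint adjs Tt st.
have [_ nd] := mo_nondeg_target mo.
have lt := lT Tt; have ls := lS Ss.
have liter j : linear (iter j t).
  by elim: j => [//|j IH] a x y; rewrite !iterS IH lt.
have growth u : linear_span (product_set M (adjoint_set M)) u ->
    forall k, exists2 C, 0 <= C & forall j, `|iter j t (u k)| <= C * c ^+ j.
  move=> Eu; pose P := [set u : K -> K | forall k, exists2 C, 0 <= C &
    forall j, `|iter j t (u k)| <= C * c ^+ j]; suff : P u by [].
  apply: span_ind Eu => [k|a v w vP wP k|_ [m [n' [Mm [n Mn nn'] ->]]] k].
  - exists 0 => // j.
    by rewrite (lin0 (liter j)) normr0 mul0r.
  - have [C C0 hC] := vP k; have [D D0 hD] := wP k.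
    exists (`|a| * C + D) => [|j]; first by rewrite addr_ge0// mulr_ge0.
    rewrite !fctE (linD (liter j)) (linZ (liter j)).
    rewrite (le_trans (ler_normD _ _))// mulrDl lerD// normrZ -mulrA.
    by rewrite ler_wpM2l.
  have [d /ltW d0 hd] := boundedP (bM Mm).
  have [m' mm' _] := adjoint_exists (bM Mm).
  exists (d * `|n' k|) => [|j]; first by rewrite mulr_ge0.
  have -> : iter j t (m (n' k)) = m (iter j s (n' k)).
    by elim: j => [//|j IH]; rewrite !iterS IH (st _ _ Mm mm').1.
  rewrite (le_trans (hd _))// -mulrA ler_wpM2l//.
  elim: j => [|j IH]; first by rewrite expr0 mulr1.
  rewrite iterS (le_trans (hs _))// exprS mulrCA ler_wpM2l//.
have range u : linear_span (product_set M (adjoint_set M)) u ->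
    forall k, `|t (u k)| <= c * `|u k|.
  move=> Eu k; have [C C0 hC] := growth u Eu k.
  pose z := u k; pose a j := complex.Re `|iter j t z|.
  have aE j : (a j)%:C%C = `|iter j t z| by rewrite RRe_real// normr_real.
  have cE : (complex.Re c)%:C%C = c by rewrite RRe_real// ger0_real.
  have CE : (complex.Re C)%:C%C = C by rewrite RRe_real// ger0_real.
  suff : a 1%N <= complex.Re c * a 0%N by rewrite -lecR rmorphM/= !aE cE.
  apply: (@logconvex_growth R a (complex.Re C) (complex.Re c)).
  - by move=> j; rewrite -ler0c aE.
  (* Log-convexity is Cauchy-Schwarz for [|t^(j+1) z|^2 = <t^j z, t^(j+2) z>], where [t] is
     selfadjoint. *)
  - move=> j; rewrite -lecR rmorphXn rmorphM/= !aE -norm_dot.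
    rewrite {1}iterS adjt -iterS (le_trans (real_ler_norm _))//; last first.
      exact: dot_norm_le.
    by rewrite iterS -adjt norm_dot rpredX// normr_real.
  - by rewrite -ler0c cE.
  - by move=> j; rewrite -lecR rmorphM rmorphXn/= aE cE CE; exact: hC.
have [b /ltW b0 hb] := boundedP (cs_bounded cT Tt).
move=> k; apply: (@le_eps _ _ _ ((c + b) * `|k|)).
  by rewrite mulr_ge0// addr_ge0.
move=> e e0; have [u Eu hu] := nd _ e0.
have uk : `|k - u k| <= e * `|k| by exact: hu.
rewrite (_ : t k = t (u k) + t (k - u k)); last by rewrite -(linD lt) addrC subrK.
rewrite (le_trans (ler_normD _ _))//.
rewrite (_ : c * _ + _ = c * (`|k| + e * `|k|) + b * (e * `|k|)); last by ring.
rewrite lerD//.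
  rewrite (le_trans (range _ Eu k))// ler_wpM2l//.
  rewrite (_ : u k = k - (k - u k)); last by rewrite subKr.
  by rewrite (le_trans (ler_normB _ _))// lerD2l.
by rewrite (le_trans (hb _))// ler_wpM2l.
Qed.

End Morita.

(** * Order isomorphisms given as relations *)

Section RelationIso.
Context {R : realType} {X Y : topologicalType}.
Context {S : set (Cfun R X)} {T : set (Cfun R Y)} {rel : Cfun R X -> Cfun R Y -> Prop}.
Hypothesis rel_dom : forall f g, rel f g -> S f /\ T g.
Hypothesis rel_total : forall f, S f -> exists g, rel f g.
Hypothesis rel_onto : forall g, T g -> exists f, rel f g.
Hypothesis rel_linear : forall a f g f' g', rel f g -> rel f' g' ->
  rel (a *: f + f') (a *: g + g').
Hypothesis rel1 : rel (cst 1) (cst 1).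
Hypothesis rel_pos : forall f g, rel f g ->
  (forall x, 0 <= f x) <-> (forall y, 0 <= g y).

Let relB f g f' g' : rel f g -> rel f' g' -> rel (f - f') (g - g').
Proof.
by move=> h h'; have := rel_linear (-1) h' h; rewrite !scaleN1r addrC [- g' + _]addrC.
Qed.

Let rel0 : rel 0 0.
Proof. by have := relB rel1 rel1; rewrite !subrr. Qed.

Let relZ a f g : rel f g -> rel (a *: f) (a *: g).
Proof. by move=> h; have := rel_linear a h rel0; rewrite !addr0. Qed.

Let relN f g : rel f g -> rel (- f) (- g).
Proof. by move=> h; have := relB rel0 h; rewrite !sub0r. Qed.

Let rel_sum n (F : 'I_n -> Cfun R X) (G : 'I_n -> Cfun R Y) :
  (forall i, rel (F i) (G i)) -> rel (\sum_i F i) (\sum_i G i).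
Proof.
move=> h; elim/big_rec2: _ => // i g f _ fg.
by rewrite -[F i]scale1r -[G i]scale1r; exact: rel_linear.
Qed.

(** A function related to 0 is positive and so is its negative, hence it vanishes. This makes the
    relation single-valued, and injective by the same argument. *)
Let rel_fun f g g' : rel f g -> rel f g' -> g = g'.
Proof.
move=> h h'; have := relB h h'; rewrite subrr => h0.
apply/funext => y; apply/subr0_eq/le_anti/andP; split; last first.
  by move: y; apply/(rel_pos h0).
rewrite -oppr_ge0; have h1 := relN h0; rewrite oppr0 in h1.
by move: y; apply/(rel_pos h1).
Qed.

Let rel_inj f f' g : rel f g -> rel f' g -> f = f'.
Proof.
move=> h h'; have := relB h h'; rewrite subrr => h0.
apply/funext => y; apply/subr0_eq/le_anti/andP; split; last first.
  by move: y; apply/(rel_pos h0).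
rewrite -oppr_ge0; have h1 := relN h0; rewrite oppr0 in h1.
by move: y; apply/(rel_pos h1).
Qed.

(* On functions, positivity of a matrix is positivity of all its compressions
   to scalar vectors, so an order isomorphism is a complete one. *)
Lemma relation_isomorphic : unital_complete_order_isomorphic S T.
Proof.
(* Outside [S] the value 0 is an arbitrary default. *)
have /choice[phi hphi] f : exists g, S f -> rel f g.
  by have [/rel_total[g fg]|nSf] := EM (S f); [exists g|exists 0].
have S_lin a f f' : S f -> S f' -> S (a *: f + f').
  move=> /hphi h /hphi h'; exact: (rel_dom (rel_linear a h h')).1.
exists phi; last first.
  apply/seteqP; split=> [_ [f /hphi/rel_dom[_ +] <-]//|g /rel_onto[f fg]].
  have [Sf _] := rel_dom fg.
  by exists f => //; exact: rel_fun (hphi _ Sf) fg.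
split.
- by move=> f /hphi/rel_dom[].
- move=> a f f' Sf Sf'; apply: rel_fun (hphi _ (S_lin a _ _ Sf Sf')) _.
  by apply: rel_linear; exact: hphi.
- by apply: rel_fun rel1; apply: hphi; exact: (rel_dom rel1).1.
- move=> f f' Sf Sf' e; apply: rel_inj (hphi _ Sf) _.
  by rewrite e; exact: hphi.
move=> n F SF.
pose f v : Cfun R X := \sum_(i < n) \sum_(j < n) (v j * (v i)^*) *: F i j.
pose g v : Cfun R Y := \sum_(i < n) \sum_(j < n) (v j * (v i)^*) *: phi (F i j).
have fg v : rel (f v) (g v).
  by do 2!(apply: rel_sum => ?); apply: relZ; exact: hphi.
have fE v x : f v x = \sum_i \sum_j F i j x * v j * (v i)^*.
  rewrite /f fct_sumE; apply: eq_bigr => i _; rewrite fct_sumE.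
  by apply: eq_bigr => j _; exact: etrans (mulrC _ _) (mulrA _ _ _).
have gE v x : g v x = \sum_i \sum_j (map_mx phi F) i j x * v j * (v i)^*.
  rewrite /g fct_sumE; apply: eq_bigr => i _; rewrite fct_sumE.
  by apply: eq_bigr => j _; rewrite mxE; exact: etrans (mulrC _ _) (mulrA _ _ _).
split=> pos x v; first rewrite -gE; last rewrite -fE.
  by move: x; apply/(rel_pos (fg v)) => x; rewrite fE; exact: pos.
by move: x; apply/(rel_pos (fg v)) => x; rewrite gE; exact: pos.
Qed.

End RelationIso.

Lemma intertwine_sym (R : realType) (H K : hilbertSpace R) (M : set (H -> K)) s t :
  intertwine M s t -> intertwine (adjoint_set M) t s.
Proof.
move=> st m' n [m Mm mm'] m'n.
rewrite -(adjoint_unique (adjoint_sym mm') m'n).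
by have [h1 h2] := st _ _ Mm mm'; split=> k; rewrite ?h1 ?h2.
Qed.

Lemma intertwine_linear (R : realType) (H K : hilbertSpace R) (M : set (H -> K)) a s t s' t' :
  M `<=` bounded_operator H K -> intertwine M s t -> intertwine M s' t' ->
  intertwine M (a *: s + s') (a *: t + t').
Proof.
move=> bM st st' m m' Mm mm'.
have [h1 h2] := st _ _ Mm mm'; have [h1' h2'] := st' _ _ Mm mm'.
have lm := bounded_lin (bM _ Mm); have lm' := adjoint_linear mm'.
split=> h; rewrite !fctE; first by rewrite h1 h1' (linD lm) (linZ lm).
by rewrite h2 h2' (linD lm') (linZ lm').
Qed.

(** * From a TRO equivalence to an isomorphism of the closures *)

Section Related.
Context {R : realType} {X Y : topologicalType}.
Context {S : set (Cfun R X)} {T : set (Cfun R Y)} {H K : hilbertSpace R}.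
Context {phi : Cfun R X -> Bop H} {psi : Cfun R Y -> Bop K} {M : set (H -> K)}.
Hypothesis cptX : compact [set: X].
Hypothesis cptY : compact [set: Y].
Hypothesis fsS : function_system S.
Hypothesis fsT : function_system T.
Hypothesis hphi :
  unital_complete_order_embedding S (bounded_operator H H : set (Bop H)) phi.
Hypothesis hpsi :
  unital_complete_order_embedding T (bounded_operator K K : set (Bop K)) psi.
Hypothesis mo : morita (op_closure (phi @` S)) (op_closure (psi @` T)) M.

Definition related (f : Cfun R X) (g : Cfun R Y) : Prop :=
  exists A B, [/\ closed_graph (S := S) (phi := phi) f A,
    closed_graph (S := T) (phi := psi) g B & intertwine M A B].

Lemma related_total f : sup_closure S f -> exists g, related f g.
Proof.
move=> /(closed_graph_total cptX fsS hphi)[A fA].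
have [B TB AB] := intertwine_exists mo (closed_graph_op fA).
have [g gB] := closed_graph_onto cptY fsT hpsi TB.
by exists g, A, B.
Qed.

(* With 0 <= f <= c, positivity is |f - c/2| <= c/2, and intertwiners of
   selfadjoint operators are contractive. *)
Lemma related_pos f g : related f g -> (forall x, 0 <= f x) -> forall y, 0 <= g y.
Proof.
move=> [A [B [fA gB AB]]] f0.
have [cf bA _] := fA.
have [c c0 fc] := compact_fun_bounded cptX cf.
have c2 : 0 <= c / 2 by rewrite divr_ge0// ltW.
have adjA : is_adjoint A A.
  have [A' AA' _] := adjoint_exists bA.
  have := closed_graph_adjoint cptX fsS hphi fA AA'.
  rewrite (_ : (fun x => (f x)^*) = f); last first.
    by apply/funext => x; rewrite geC0_conj.
  by move=> /(closed_graph_op_unique cptX fsS hphi fA) => {2}->.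
pose A1 := - (c / 2) *: idfun + A; pose B1 := - (c / 2) *: idfun + B.
have fA1 : closed_graph (S := S) (phi := phi) (- (c / 2) *: cst 1 + f) A1.
  exact: (closed_graph_linear fsS hphi _ (closed_graph1 fsS hphi) fA).
have gB1 : closed_graph (S := T) (phi := psi) (- (c / 2) *: cst 1 + g) B1.
  exact: (closed_graph_linear fsT hpsi _ (closed_graph1 fsT hpsi) gB).
have id2 : intertwine M idfun idfun by [].
have AB1 : intertwine M A1 B1 by exact: (intertwine_linear _ (mo_bounded mo) id2 AB).
have adjA1 : is_adjoint A1 A1.
  have := adjoint_add (- (c / 2)) (@adjoint_id _ H) adjA.
  by rewrite rmorphN/= geC0_conj.
have nA1 : op_norm_le A1 (c / 2).
  apply/(closed_graph_norm cptX fsS hphi c2 fA1) => x.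
  have -> : (- (c / 2) *: cst 1 + f : Cfun R X) x = f x - c / 2.
    by rewrite !fctE /GRing.scale/= mulr1 addrC.
  rewrite real_ler_norml; last by rewrite rpredB ?ger0_real.
  rewrite lerBrDr addNr f0/= lerBlDr -splitr.
  by rewrite (le_trans _ (fc x))// real_ler_norm// ger0_real.
have SA1 := closed_graph_op fA1; have TB1 := closed_graph_op gB1.
have nB1 := intertwine_norm mo SA1 TB1 adjA1 AB1 c2 nA1.
have adjB := intertwine_selfadjoint mo adjA (closed_graph_op gB) AB.
apply/(closed_graph_pos1 cptY fsT hpsi gB adjB) => k.
have Breal : hdot (B k) k \is Num.real by apply/CrealP; rewrite -dotC adjB.
have BE : hdot (B1 k) k = hdot (B k) k - c / 2 * `|k| ^+ 2.
  by rewrite /B1 !fctE dotDl dotZl norm_dot mulNr addrC.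
have B1real : hdot (B1 k) k \is Num.real.
  by rewrite BE rpredB// ger0_real// mulr_ge0// exprn_ge0.
have : - hdot (B1 k) k <= c / 2 * `|k| ^+ 2.
  rewrite (le_trans (real_ler_norm _)) ?rpredN// normrN.
  by rewrite (le_trans (dot_norm_le _ _))// expr2 mulrA ler_wpM2r// nB1.
by rewrite BE opprB lerBlDr lerDl.
Qed.

End Related.

Lemma related_sym (R : realType) (X Y : topologicalType)
  (S : set (Cfun R X)) (T : set (Cfun R Y)) (H K : hilbertSpace R)
  (phi : Cfun R X -> Bop H) (psi : Cfun R Y -> Bop K) (M : set (H -> K)) f g :
  related (S := S) (T := T) (phi := phi) (psi := psi) (M := M) f g ->
  related (S := T) (T := S) (phi := psi) (psi := phi) (M := adjoint_set M) g f.
Proof. by move=> [A [B [fA gB AB]]]; exists B, A; split=> //; exact: intertwine_sym. Qed.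

Lemma Delta_equivalent_isomorphic (R : realType) (X Y : topologicalType)
  (S : set (Cfun R X)) (T : set (Cfun R Y)) :
  compact [set: X] -> compact [set: Y] ->
  function_system S -> function_system T -> Delta_equivalent S T ->
  unital_complete_order_isomorphic (sup_closure S) (sup_closure T).
Proof.
move=> cptX cptY fsS fsT [H [K [phi [psi [hphi hpsi [cS cT [M]]]]]]].
move=> [[bM lM _] [nS nT] pull push].
have mo : morita (op_closure (phi @` S)) (op_closure (psi @` T)) M.
  have bM' m m' : M m -> is_adjoint m m' -> bounded_operator K H m'.
    by move=> Mm mm'; exact: (adjoint_bounded (bM _ Mm) mm').
  split=> //.
  - exact: closed_system_op_closure cptX fsS hphi.
  - exact: closed_system_op_closure cptY fsT hpsi.
  - by case: lM.
  (* The hypotheses on M concern the images of S and T only; continuity of two-sided multiplication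
     extends them to the closures. *)
  - move=> m m' n t Mm mm' Mn; apply: op_closure_comp; [exact: bM' mm'|exact: bM|].
    move=> s Ts; apply: pull; exists (m' \o s), n; split=> //.
    by exists m', s; split=> //; exists m.
  - move=> m n n' s Mm Mn nn'; apply: op_closure_comp; [exact: bM|exact: bM' nn'|].
    move=> t St; apply: push; exists (m \o t), n'; split=> //; last by exists n.
    by exists m, t.
have mo' := morita_sym mo.
apply: (@relation_isomorphic _ _ _ _ _
  (related (S := S) (T := T) (phi := phi) (psi := psi) (M := M))).
- by move=> f g [A [B [fA gB _]]]; split; [exact: closed_graph_fun fA|exact: closed_graph_fun gB].
- exact: related_total cptX cptY fsS fsT hphi hpsi mo.
(* Surjectivity is totality for the reversed equivalence, because taking adjoints of M twice gives M
   back. *)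
- move=> g /(related_total cptY cptX fsT fsS hpsi hphi mo')[f /related_sym].
  by rewrite adjoint_setK//; exists f.
- move=> a f g f' g' [A [B [fA gB AB]]] [A' [B' [fA' gB' AB']]].
  exists (a *: A + A'), (a *: B + B'); split.
  + exact: closed_graph_linear.
  + exact: closed_graph_linear.
  + exact: intertwine_linear.
- by exists idfun, idfun; split=> //; exact: closed_graph1.
move=> f g fg; split.
  exact: (related_pos cptX cptY fsS fsT hphi hpsi mo fg).
exact: (related_pos cptY cptX fsT fsS hpsi hphi mo' (related_sym fg)).
Qed.

(** * The Hilbert space of square summable families *)

Section UnorderedSum.
Context {R : realType} {I : choiceType}.
Implicit Types (u v : I -> R[i]) (J : {fset I}) (l : R[i]).

(** Convergence of the net of finite partial sums: the indices will be the points of a space,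
    possibly uncountably many. *)
Definition unordered_sum u l := forall e : R[i], 0 < e ->
  exists J0, forall J, (J0 `<=` J)%fset -> `|\sum_(i <- J) u i - l| <= e.

Lemma unordered_sum_unique u l l' :
  unordered_sum u l -> unordered_sum u l' -> l = l'.
Proof.
move=> h h'; apply/subr0_eq/eqP; rewrite -normr_le0.
apply: (@le_eps _ _ _ 2) => // e e0; rewrite add0r.
have [J hJ] := h _ e0; have [J' hJ'] := h' _ e0.
have h1 := hJ _ (fsubsetUl J J'); have h2 := hJ' _ (fsubsetUr J J').
rewrite (_ : l - l' = (\sum_(i <- (J `|` J')%fset) u i - l') -
   (\sum_(i <- (J `|` J')%fset) u i - l)); last by ring.
by rewrite (le_trans (ler_normB _ _))// mulr_natr mulr2n lerD.
Qed.

Lemma unordered_sum_linear (a : R[i]) u v l m :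
  unordered_sum u l -> unordered_sum v m ->
  unordered_sum (fun i => a * u i + v i) (a * l + m).
Proof.
move=> h h' e e0; pose d := e / (`|a| + 1).
have a0 : 0 < `|a| + 1 by rewrite ltr_wpDl.
have d0 : 0 < d by rewrite divr_gt0.
have [J hJ] := h _ d0; have [J' hJ'] := h' _ d0.
exists (J `|` J')%fset => L; rewrite fsubUset => /andP[JL JL'].
rewrite big_split -mulr_sumr/=.
rewrite (_ : _ - _ = a * (\sum_(i <- L) u i - l) + (\sum_(i <- L) v i - m)); last first.
  by ring.
rewrite (_ : e = `|a| * d + d); last by rewrite /d; field; exact/lt0r_neq0.
rewrite (le_trans (ler_normD _ _))// normrM lerD//; last exact: hJ'.
by rewrite ler_wpM2l// hJ.
Qed.

Lemma unordered_sum_conj u l : unordered_sum u l ->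
  unordered_sum (fun i => (u i)^*) l^*.
Proof.
move=> h e /h[J hJ]; exists J => L /hJ.
by rewrite -norm_conjC rmorphB/= rmorph_sum.
Qed.

Lemma unordered_sum0 : unordered_sum (fun=> 0) 0.
Proof. by move=> e e0; exists fset0%fset => J _; rewrite big1// subrr normr0 ltW. Qed.

Lemma unordered_sum_finite u J : (forall i, i \notin J -> u i = 0) ->
  unordered_sum u (\sum_(i <- J) u i).
Proof.
move=> uJ e e0; exists J => L JL.
rewrite (big_fset_incl _ JL); first by rewrite subrr normr0 ltW.
by move=> i _ /uJ.
Qed.

Lemma ler_sum_fset u J J' : (forall i, 0 <= u i) -> (J `<=` J')%fset ->
  \sum_(i <- J) u i <= \sum_(i <- J') u i.
Proof.
move=> u0 JJ'; rewrite (big_fsetID _ (mem J) J')/=.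
rewrite (_ : [fset i in J' | i \in J]%fset = J).
  by rewrite lerDl sumr_ge0.
apply/fsetP => i; rewrite !inE/= andbC; apply: andb_idr.
by move/fsubsetP: JJ' => /(_ i).
Qed.

Lemma sum_le_unordered_sum u l J : (forall i, 0 <= u i) -> unordered_sum u l ->
  \sum_(i <- J) u i <= l.
Proof.
move=> u0 h; rewrite -subr_ge0; apply: (@ge0_closed _ _ 1) => // e /h[J' hJ'].
exists (\sum_(i <- (J `|` J')%fset) u i - \sum_(i <- J) u i).
  by rewrite subr_ge0 ler_sum_fset// fsubsetUl.
rewrite mulr1 (le_trans _ (hJ' _ (fsubsetUr J J')))//.
by rewrite [leLHS]distrC opprB addrA subrK.
Qed.

Lemma unordered_sum_le u l c : (forall J, \sum_(i <- J) u i <= c) ->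
  unordered_sum u l -> l <= c.
Proof.
move=> uc h; rewrite -subr_ge0; apply: (@ge0_closed _ _ 1) => // e /h[J hJ].
exists (c - \sum_(i <- J) u i); first by rewrite subr_ge0.
by rewrite mulr1 opprB addrC addrA subrK hJ.
Qed.

Lemma unordered_sum_exists u (c : R[i]) : (forall i, 0 <= u i) ->
  (forall J, \sum_(i <- J) u i <= c) -> exists l, unordered_sum u l.
Proof.
move=> u0 uc; pose s J := complex.Re (\sum_(i <- J) u i).
have sE J : (s J)%:C%C = \sum_(i <- J) u i by rewrite RRe_real// ger0_real// sumr_ge0.
have c0 : 0 <= c by apply: le_trans (uc fset0%fset); rewrite sumr_ge0.
have cE : (complex.Re c)%:C%C = c by rewrite RRe_real// ger0_real.
have supE : has_sup (range s).
  split; first by exists (s fset0%fset); exists fset0%fset.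
  by exists (complex.Re c) => _ [J _ <-]; rewrite -lecR sE cE.
exists (sup (range s))%:C%C => e e0.
have eE : (complex.Re e)%:C%C = e by rewrite RRe_real// gtr0_real.
have e0' : 0 < complex.Re e by rewrite -ltcR eE.
have [_ [J _ <-] hJ] := sup_adherent e0' supE.
exists J => L JL; rewrite -sE -rmorphB/= normc_def/= expr0n/= addr0 sqrtr_sqr.
have h1 : s L <= sup (range s) by apply: ub_le_sup; [exact: supE.2|exists L].
have h2 : s J <= s L by rewrite -lecR !sE ler_sum_fset.
by rewrite -eE lecR ler0_norm ?subr_le0// opprB lerBlDr -lerBlDl (le_trans _ h2)// ltW.
Qed.

End UnorderedSum.

Section SquareSummable.
Context {R : realType} {I : choiceType}.
Implicit Types f g : I -> R[i]^o.

Definition square_summable f := exists c : R[i],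
  forall J : {fset I}, \sum_(i <- J) `|f i| ^+ 2 <= c.

Lemma square_summable_linear (a : R[i]) f g :
  square_summable f -> square_summable g -> square_summable (a *: f + g).
Proof.
move=> [c hc] [d hd]; exists (2 * `|a| ^+ 2 * c + 2 * d) => J.
apply: (@le_trans _ _ (\sum_(i <- J) (2 * `|a| ^+ 2 * `|f i| ^+ 2 + 2 * `|g i| ^+ 2))).
  apply: ler_sum => i _; rewrite (_ : (a *: f + g) i = a * f i + g i)//.
  apply: (@le_trans _ _ ((`|a| * `|f i| + `|g i|) ^+ 2)).
    by rewrite lerXn2r ?nnegrE ?addr_ge0 ?mulr_ge0// (le_trans (ler_normD _ _))// normrM.
  rewrite -subr_ge0 (_ : _ - _ = (`|a| * `|f i| - `|g i|) ^+ 2); last by ring.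
  by rewrite -realEsqr rpredB ?ger0_real ?mulr_ge0.
by rewrite big_split -!mulr_sumr/= lerD// ler_wpM2l.
Qed.

Lemma square_summable0 : square_summable 0.
Proof. by exists 0 => J; rewrite big1// => i _; rewrite (_ : (0 : I -> R[i]^o) i = 0)// normr0 expr0n. Qed.

(** Polarisation writes [f i * (g i)^*] as a combination of [|a * g i + f i|^2] for the four values
    [1], [-1], ['i], [- 'i] of [a], so that only sums of nonnegative terms have to be shown to
    exist. *)
Lemma square_summable_dot f g : square_summable f -> square_summable g ->
  exists l, unordered_sum (fun i => f i * (g i)^*) l.
Proof.
move=> hf hg.
have N (a : R[i]) : exists l, unordered_sum (fun i => `|a * g i + f i| ^+ 2) l.
  have [c hc] := square_summable_linear a hg hf.
  by apply: (@unordered_sum_exists _ _ _ c) => // i; rewrite exprn_ge0.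
have [l1 h1] := N 1; have [l2 h2] := N (-1).
have [l3 h3] := N 'i; have [l4 h4] := N (- 'i).
have z : unordered_sum (fun=> 0 : R[i]) (0 : R[i]) := @unordered_sum0 R I.
have := unordered_sum_linear 4^-1 h1 (unordered_sum_linear (- 4^-1) h2
  (unordered_sum_linear ('i / 4) h3 (unordered_sum_linear (- ('i / 4)) h4 z))).
set l := (X in unordered_sum _ X) => h; exists l; move: h.
rewrite (_ : (fun i => _) = (fun i => f i * (g i)^*))//.
apply/funext => i; rewrite !normCK !rmorphD !rmorphM rmorphN rmorph1/= rmorphN/= conjCi.
have i2 : 'i * 'i = -1 :> R[i] by rewrite -expr2 sqrCi.
set x := f i; set y := g i; set x' := x^*; set y' := y^*.
(* The correction term is zero since ['i * 'i = -1]; splitting it off leaves an identity that holds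
   with any scalar in place of ['i]. *)
transitivity (x * y' - ('i * 'i + 1) * ((x * y' - x' * y) / 2)); first by field.
by rewrite i2; ring.
Qed.

End SquareSummable.

Section L2Type.
Context {R : realType} {I : choiceType}.

Definition l2_pred : {pred I -> R[i]^o} := fun f => `[< square_summable f >].

Fact l2_submod_closed : submod_closed l2_pred.
Proof.
split=> [|a f g]; first by apply/asboolP; exact: square_summable0.
by move=> /asboolP hf /asboolP hg; apply/asboolP; exact: square_summable_linear.
Qed.

HB.instance Definition _ := GRing.isSubmodClosed.Build _ _ l2_pred l2_submod_closed.

Record l2 : Type := L2 { l2_fun :> I -> R[i]^o; l2P : l2_fun \in l2_pred }.

HB.instance Definition _ := [isSub for l2_fun].
HB.instance Definition _ := [Choice of l2 by <:].
HB.instance Definition _ := [SubChoice_isSubLmodule of l2 by <:].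

Implicit Types f g : l2.

Lemma l2_summable f : square_summable f.
Proof. by have /asboolP := l2P f. Qed.

Lemma l2_linear (a : R[i]) f g i : (a *: f + g) i = a * f i + g i.
Proof. by []. Qed.

Definition l2_dot f g : R[i] := projT1 (cid (square_summable_dot (l2_summable f) (l2_summable g))).

Lemma l2_dotP f g : unordered_sum (fun i => f i * (g i)^*) (l2_dot f g).
Proof. by rewrite /l2_dot; case: cid. Qed.

Lemma l2_dot_eq f g l : unordered_sum (fun i => f i * (g i)^*) l -> l2_dot f g = l.
Proof. exact: unordered_sum_unique (l2_dotP f g). Qed.

Lemma l2_dot_linear a f g h : l2_dot (a *: f + g) h = a * l2_dot f h + l2_dot g h.
Proof.
apply: l2_dot_eq; have := unordered_sum_linear a (l2_dotP f h) (l2_dotP g h).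
congr unordered_sum; apply/funext => i.
by rewrite l2_linear mulrDl mulrA.
Qed.

Lemma l2_dot_herm f g : l2_dot f g = (l2_dot g f)^*.
Proof.
apply: l2_dot_eq; have := unordered_sum_conj (l2_dotP g f).
by congr unordered_sum; apply/funext => i; rewrite rmorphM/= conjCK mulrC.
Qed.

Lemma l2_normP f : unordered_sum (fun i => `|f i| ^+ 2) (l2_dot f f).
Proof.
by have := l2_dotP f f; congr unordered_sum; apply/funext => i; rewrite normCK.
Qed.

Lemma sum_le_l2 f (J : {fset I}) : \sum_(i <- J) `|f i| ^+ 2 <= l2_dot f f.
Proof.
by apply: sum_le_unordered_sum (l2_normP f) => i; rewrite exprn_ge0.
Qed.

Lemma coord_le_l2 f i : `|f i| ^+ 2 <= l2_dot f f.
Proof. by have := sum_le_l2 f [fset i]%fset; rewrite big_seq_fset1. Qed.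

Lemma l2_dot_ge0 f : 0 <= l2_dot f f.
Proof. by have := sum_le_l2 f fset0; rewrite big_seq_fset0. Qed.

Lemma l2_ext f g : (forall i, f i = g i) -> f = g.
Proof. by move=> fg; apply/val_inj/funext => i; exact: fg. Qed.

Lemma l2_dot_eq0 f : l2_dot f f = 0 -> f = 0.
Proof.
move=> f0; apply: l2_ext => i; apply/eqP.
by rewrite -normr_eq0 -sqrf_eq0 eq_le exprn_ge0// andbT -f0 coord_le_l2.
Qed.

Definition l2_norm f : R[i] := sqrtC (l2_dot f f).

Let l2_normD f g : l2_norm (f + g) <= l2_norm f + l2_norm g.
Proof. exact: (form_minkowski l2_dot_linear l2_dot_herm l2_dot_ge0 l2_dot_eq0). Qed.

Let l2_normZ (a : R[i]) f : l2_norm (a *: f) = `|a| * l2_norm f.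
Proof.
have n0 g : 0 <= l2_norm g by rewrite sqrtC_ge0 l2_dot_ge0.
apply: (pexpIrn (n := 2)) => //; rewrite ?nnegrE ?mulr_ge0//.
rewrite exprMn !sqrtCK normCK; apply: l2_dot_eq.
have := unordered_sum_linear (a * a^*) (l2_dotP f f) (@unordered_sum0 R I).
rewrite addr0; congr unordered_sum; apply/funext => i.
by rewrite addr0 (_ : (a *: f) i = a * f i)// rmorphM/=; ring.
Qed.

Let l2_norm_eq0 f : l2_norm f = 0 -> f = 0.
Proof. by move/eqP; rewrite sqrtC_eq0 => /eqP /l2_dot_eq0. Qed.

HB.instance Definition _ := Lmodule_isNormed.Build R[i] l2 l2_normD l2_normZ l2_norm_eq0.

Lemma l2_normE f : `|f| ^+ 2 = l2_dot f f.
Proof. by rewrite sqrtCK. Qed.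

Lemma coord_le_norm f i : `|f i| <= `|f|.
Proof.
by rewrite -(@ler_pXn2r _ 2)// ?nnegrE// l2_normE coord_le_l2.
Qed.

Lemma l2_complete (F : set_system l2) : ProperFilter F -> cauchy F -> cvg F.
Proof.
apply: seq_complete => x hx.
have /choice[y hy] i : exists z : R[i], forall k, `|x k i - z| <= 1 * invS k.
  apply: complex_cauchy_limit => // k l; rewrite mul1r.
  exact: le_trans (coord_le_norm (x k - x l) i) (hx k l).
have {}hy k i : `|x k i - y i| <= invS k by rewrite -[leRHS]mul1r.
have S0 k : 0 <= invS k :> R[i] by rewrite ltW// invS_gt0.
have S1 k : invS k <= 1 :> R[i] by rewrite invf_le1 ?ler1n ?ltr0n.
have bound k (J : {fset I}) : \sum_(i <- J) `|x k i - y i| ^+ 2 <= invS k ^+ 2.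
  pose n : R[i] := \sum_(i <- J) 1.
  have n0 : 0 <= n by rewrite sumr_ge0.
  (* [3] bounds [2 * invS k + invS l]. Each of the [n] indices costs at most [2 * 2 + 1] times
     [invS l], the coordinates of [x k - x l] being at most 2. *)
  apply: (@le_eps _ _ _ (3 + 5 * n)); first by rewrite addr_ge0// mulr_ge0.
  move=> e /invS_small[l /ltW hl].
  apply: (@le_trans _ _ ((invS k + invS l) ^+ 2 + invS l * (5 * n))).
    have : \sum_(i <- J) `|x k i - x l i| ^+ 2 <= (invS k + invS l) ^+ 2.
      apply: (le_trans (sum_le_l2 (x k - x l) J)); rewrite -l2_normE.
      by rewrite lerXn2r ?nnegrE ?addr_ge0//.
    rewrite -(lerD2r (invS l * (5 * n))) => /(le_trans _); apply.
    rewrite /n !mulr_sumr -big_split /= ler_sum// => i _.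
    have h1 : `|x k i - y i| <= `|x k i - x l i| + invS l.
      rewrite (_ : x k i - y i = (x k i - x l i) + (x l i - y i)); last first.
        by rewrite addrA subrK.
      by rewrite (le_trans (ler_normD _ _))// lerD2l.
    have h2 : `|x k i - x l i| <= 2.
      rewrite (le_trans (coord_le_norm (x k - x l) i))// (le_trans (hx k l))//.
      by rewrite (_ : 2 = 1 + 1 :> R[i])// lerD.
    apply: (@le_trans _ _ ((`|x k i - x l i| + invS l) ^+ 2)).
      by rewrite lerXn2r ?nnegrE ?addr_ge0.
    rewrite sqrrD -addrA lerD2l mulr1 (_ : _ + _ =
      invS l * (2 * `|x k i - x l i| + invS l)); last by ring.
    rewrite ler_wpM2l// (_ : 5 = 2 * 2 + 1 :> R[i]); last by ring.
    by rewrite lerD// ler_wpM2l.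
  rewrite (_ : _ + _ = invS k ^+ 2 + invS l * (2 * invS k + invS l + 5 * n)); last first.
    by ring.
  rewrite lerD2l ler_pM ?lerD2r//; first by rewrite !addr_ge0 ?mulr_ge0.
  by rewrite (_ : 3 = 2 * 1 + 1 :> R[i]); [rewrite lerD// ler_wpM2l|ring].
have xy_l2 k : (fun i => x k i - y i) \in l2_pred.
  by apply/asboolP; exists (invS k ^+ 2); exact: bound.
(* [y] itself is not yet known to be square summable, but its difference from [x 0] is. *)
pose z : l2 := x 0%N - L2 (xy_l2 0%N).
have zE i : z i = y i by rewrite /z /= [LHS]subKr.
exists z => k; rewrite -(@ler_pXn2r _ 2)// ?nnegrE// l2_normE.
apply: unordered_sum_le (l2_normP _) => J.
rewrite (le_trans _ (bound k J))// ler_sum// => i _.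
by rewrite (_ : (x k - z) i = x k i - z i)// zE.
Qed.

HB.instance Definition _ := Uniform_isComplete.Build l2 l2_complete.

Definition l2_hilbert : hilbertSpace R := @make_hilbert R l2 l2_dot l2_dot_linear l2_dot_herm l2_normE.

End L2Type.

(** * Multiplication operators on square summable families *)

Section MulOp.
Context {R : realType} {I : choiceType}.
Implicit Types (f h : @l2 R I) (g : I -> R[i]^o).

(** An embedding has to be defined on all functions, so [insubd] returns 0 when the product is not
    square summable; for bounded [g] this never happens. *)
Definition mulop g f : @l2 R I := insubd 0 (fun i => g i * f i : R[i]^o).

Lemma mulopE g (c : R[i]) f i : (forall i, `|g i| <= c) -> mulop g f i = g i * f i.
Proof.
move=> hg; rewrite [LHS](_ : _ = val (insubd (0 : l2) (fun i => g i * f i : R[i]^o)) i)//.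
rewrite val_insubd ifT//; apply/asboolP.
have [d hd] := l2_summable f; exists (c ^+ 2 * d) => J.
have c0 : 0 <= c by exact: le_trans (hg i).
apply: le_trans (ler_wpM2l (exprn_ge0 2 c0) (hd J)).
rewrite mulr_sumr ler_sum// => k _; rewrite normrM exprMn ler_wpM2r ?exprn_ge0//.
by rewrite lerXn2r ?nnegrE.
Qed.

Lemma mulop_dot g (c : R[i]) f h : (forall i, `|g i| <= c) ->
  unordered_sum (fun i => g i * f i * (h i)^*) (l2_dot (mulop g f) h).
Proof.
move=> hg; have := l2_dotP (mulop g f) h; congr unordered_sum.
by apply/funext => i; rewrite (mulopE _ _ hg).
Qed.

Lemma mulop_bounded g (c : R[i]) : 0 <= c -> (forall i, `|g i| <= c) ->
  bounded_operator (@l2_hilbert R I) (@l2_hilbert R I) (mulop g).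
Proof.
move=> c0 hg; split.
  by move=> a x y; apply: l2_ext => i; rewrite l2_linear !(mulopE _ _ hg) l2_linear; ring.
exists c => x; rewrite -(@ler_pXn2r _ 2)// ?nnegrE ?mulr_ge0// exprMn !l2_normE.
apply: (unordered_sum_le _ (l2_normP (mulop g x))) => J.
apply: le_trans (ler_wpM2l (exprn_ge0 2 c0) (sum_le_l2 x J)).
rewrite mulr_sumr ler_sum// => i _; rewrite (mulopE _ _ hg) normrM exprMn.
by rewrite ler_wpM2r ?exprn_ge0// lerXn2r ?nnegrE.
Qed.

Lemma l2_delta_subproof (i : I) : (fun j => (j == i)%:R : R[i]^o) \in @l2_pred R I.
Proof.
apply/asboolP; exists 1 => J.
apply: (@le_trans _ _ (\sum_(j <- (J `|` [fset i])%fset) `|(j == i)%:R| ^+ 2)).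
  by apply: ler_sum_fset; [move=> k; rewrite exprn_ge0|exact: fsubsetUl].
rewrite (big_fsetD1 i)/=; last by rewrite !inE eqxx orbT.
rewrite eqxx normr1 expr1n big_seq big1 ?addr0// => j.
by rewrite !inE => /andP[/negPf-> _]; rewrite normr0 expr0n.
Qed.

Definition l2_delta (i : I) : @l2 R I := L2 (l2_delta_subproof i).

End MulOp.

Section MulOpEmbedding.
Context {R : realType} {X : topologicalType} (cptX : compact [set: X]).
Context {S : set (Cfun R X)} (cS : forall f, S f -> continuous f).
Hypothesis S_linear : forall a f g, S f -> S g -> S (a *: f + g).

Let bnd f : S f -> exists2 c : R[i], 0 <= c & forall x, `|f x| <= c.
Proof.
by move=> /cS/(compact_fun_bounded cptX)[c /ltW]; exists c.
Qed.

(** The form of the operator matrix is the sum over all points [x] of the forms of [F(x)], so it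
    inherits positivity. Conversely the vectors [v j *: l2_delta x] isolate a single point; as every
    point has its own delta vector, no measure of full support is involved. *)
Lemma mulop_embedding : unital_complete_order_embedding S
  (bounded_operator l2_hilbert l2_hilbert : set (Bop (@l2_hilbert R X))) mulop.
Proof.
have mE f (x : l2) i : S f -> mulop f x i = f i * x i.
  by move=> /bnd[c _ hc]; exact: mulopE hc.
split.
- by move=> f /bnd[c c0 hc]; exact: mulop_bounded hc.
- move=> a f g Sf Sg; apply/funext => x; apply: l2_ext => i.
  rewrite (mE _ _ _ (S_linear a Sf Sg)) [RHS]l2_linear !mE//.
  by rewrite mulrA -mulrDl.
- apply/funext => x; apply: l2_ext => i.
  by rewrite (@mulopE _ _ _ 1) /= ?mul1r// => j; rewrite normr1.
- move=> f g Sf Sg fg; apply/funext => i.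
  by have := congr1 (fun A => l2_fun (A (l2_delta i)) i) fg; rewrite !mE//= eqxx !mulr1.
move=> n F SF; split=> [pos h|pos x v].
  have zero := @unordered_sum0 R X.
  have add u w l m : unordered_sum u l -> unordered_sum w m ->
      unordered_sum (fun i : X => u i + w i) (l + m : R[i]).
    move=> hu hw; have := unordered_sum_linear 1 hu hw; rewrite mul1r.
    by congr unordered_sum; apply/funext => i; rewrite mul1r.
  have sum m (u : 'I_m -> X -> R[i]) l : (forall i, unordered_sum (u i) (l i)) ->
      unordered_sum (fun x => \sum_(i < m) u i x) (\sum_(i < m) l i).
    elim: m u l => [|m IH] u l hu.
      by rewrite big_ord0; have := zero; congr unordered_sum; apply/funext => i; rewrite big_ord0.
    rewrite big_ord_recl; have := add _ _ _ _ (hu ord0) (IH _ _ (fun i => hu (lift ord0 i))).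
    by congr unordered_sum; apply/funext => i; rewrite big_ord_recl.
  have dotE i j : unordered_sum (fun x => F i j x * h j x * (h i x)^*)
      (l2_dot (mulop (F i j) (h j)) (h i)).
    by have [c _ hc] := bnd (SF i j); exact: mulop_dot hc.
  (* The empty partial sum is the lower bound 0. *)
  have := sum_le_unordered_sum fset0 _ (sum _ _ _ (fun i => sum _ _ _ (dotE i))).
  rewrite big_seq_fset0 => /(_ (fun x => pos x (fun j => h j x))).
  by congr (0 <= _); do 2!(apply: eq_bigr => ? _); rewrite mxE.
have := pos (fun j => v j *: l2_delta x).
congr (0 <= _); apply: eq_bigr => i _; apply: eq_bigr => j _; rewrite mxE.
have [c _ hc] := bnd (SF i j).
apply: unordered_sum_unique (mulop_dot _ _ hc) _.
have := @unordered_sum_finite R X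
  (fun y => F i j y * (v j * (y == x)%:R) * (v i * (y == x)%:R)^*) [fset x]%fset.
rewrite big_seq_fset1 eqxx !mulr1; apply=> y.
by rewrite inE => /negPf ->; rewrite !mulr0 mul0r.
Qed.

End MulOpEmbedding.

(** * Isomorphic closures *)

Section EmbeddingComposition.
Context {R : realType} {U V W : matrixOrderedSpace R}.

Lemma embedding_comp (S : set U) (T : set V) (Z : set W) f g :
  unital_complete_order_embedding S T f -> unital_complete_order_embedding T Z g ->
  unital_complete_order_embedding S Z (g \o f).
Proof.
move=> [fT flin f1 finj fpos] [gZ glin g1 ginj gpos]; split.
- by move=> u /fT/gZ.
- by move=> a u v Su Sv /=; rewrite flin// glin//; exact: fT.
- by rewrite /= f1.
- by move=> u v Su Sv /ginj-/(_ (fT _ Su) (fT _ Sv)); exact: finj.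
move=> n A SA; rewrite map_mx_comp fpos//; apply: gpos => i j.
by rewrite mxE; exact: fT.
Qed.

Lemma embedding_sub (S S' : set U) (Z : set W) f : S' `<=` S ->
  unital_complete_order_embedding S Z f -> unital_complete_order_embedding S' Z f.
Proof.
move=> sub [fT flin f1 finj fpos]; split=> //.
- by move=> u /sub/fT.
- by move=> a u v /sub Su /sub Sv; exact: flin.
- by move=> u v /sub Su /sub Sv; exact: finj.
by move=> n A SA; apply: fpos => i j; exact/sub/SA.
Qed.

End EmbeddingComposition.

Section SupClosure.
Context {R : realType} {X : topologicalType} {S : set (Cfun R X)}.
Hypothesis fsS : function_system S.

Lemma sub_sup_closure : S `<=` sup_closure S.
Proof.
move=> f Sf; split; first by case: fsS => h _ _ _ _; exact: h.
by move=> e e0; exists f => // x; rewrite subrr normr0 ltW.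
Qed.

Lemma sup_closure_linear a (f g : Cfun R X) :
  sup_closure S f -> sup_closure S g -> sup_closure S (a *: f + g).
Proof.
move=> [cf hf] [cg hg]; split.
  by move=> x; apply: (@cvgD _ R[i]^o); [apply: cvgZr; exact: cf|exact: cg].
move=> e e0; pose d := e / (`|a| + 1).
have a0 : 0 < `|a| + 1 by rewrite ltr_wpDl.
have d0 : 0 < d by rewrite divr_gt0.
have dE : `|a| * d + d = e by rewrite /d; field; exact/lt0r_neq0.
have [f' Sf' ff'] := hf _ d0; have [g' Sg' gg'] := hg _ d0.
exists (a *: f' + g'); first by case: fsS => _ [_ h] _ _ _; exact: h.
move=> x; rewrite -dE (_ : _ - _ = a * (f x - f' x) + (g x - g' x)); last first.
  by rewrite !fctE /GRing.scale/=; ring.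
by rewrite (le_trans (ler_normD _ _))// lerD// normrM ler_wpM2l.
Qed.

Lemma sup_closure_function_system : function_system (sup_closure S).
Proof.
split.
- by move=> f [].
- split; last by move=> a f g; exact: sup_closure_linear.
  by apply: sub_sup_closure; case: fsS => _ [].
- move=> f [cf hf]; split=> [x|e /hf[g Sg fg]].
    apply/cvgrPdist_lt => e e0; have /cvgrPdist_lt/(_ _ e0) := cf x.
    by apply: filterS => y; rewrite -rmorphB/= norm_conjC.
  exists (fun x => (g x)^*); first by case: fsS => _ _ h _ _; exact: h.
  by move=> x; rewrite -rmorphB/= norm_conjC.
- by apply: sub_sup_closure; case: fsS.
move=> x y xy; have [_ _ _ _ /(_ x y xy)[f Sf fxy]] := fsS.
by exists f => //; exact: sub_sup_closure.
Qed.

(** The closure is itself a function system, so [phi] is isometric on it and turns uniform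
    approximants from [S] into norm approximants. *)
Lemma embedding_sup_closure (H : hilbertSpace R) (phi : Cfun R X -> Bop H) f :
  compact [set: X] ->
  unital_complete_order_embedding (sup_closure S)
    (bounded_operator H H : set (Bop H)) phi ->
  sup_closure S f -> op_closure (phi @` S) (phi f).
Proof.
move=> cptX hphi Sf; have [bphi phi_lin _ _ _] := hphi.
split=> [|e e0]; first exact: bphi.
have [_ /(_ _ e0)[g Sg fg]] := Sf; have Sg' := sub_sup_closure Sg.
exists (phi g); first by exists g.
rewrite (_ : phi f - phi g = phi (-1 *: g + f)); last first.
  by rewrite phi_lin// scaleN1r addrC.
apply/(embedding_norm cptX sup_closure_function_system hphi (ltW e0)).
  exact: sup_closure_linear.
by move=> x; rewrite scaleN1r !fctE addrC.
Qed.

End SupClosure.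

(** * The TRO of scalar operators, and TRO equivalence from isomorphic closures *)

Section ScalarTRO.
Context {R : realType} {H : hilbertSpace R}.

Definition scalar_operators : set (H -> H) := [set A | exists c : R[i], A = c *: idfun].

Let scalar_adjoint B : adjoint_set scalar_operators B -> scalar_operators B.
Proof.
move=> [_ [c ->] adj]; exists c^*; apply: adjoint_unique adj _ => x y.
by rewrite !fctE dotZl dotZr conjCK.
Qed.

Let id_scalar : scalar_operators idfun.
Proof. by exists 1; rewrite scale1r. Qed.

Let id_adjoint : adjoint_set scalar_operators idfun.
Proof. by exists idfun. Qed.

Lemma scalar_TRO : TRO scalar_operators.
Proof.
split=> [_ [c ->]||_ [_ [_ [[_ [B [[a ->] /scalar_adjoint[b ->] ->]]] [c ->] ->]]]].
- rewrite -[_ *: _]addr0; apply: bounded_add; [exact: bounded_id|exact: bounded0].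
- split=> [|a _ _ [b ->] [c ->]]; first by exists 0; rewrite scale0r.
  by exists (a * b + c); rewrite scalerDl scalerA.
exists (a * b * c); apply/funext => x /=.
by rewrite !fctE !scalerA.
Qed.

Let id_span (E : set (H -> H)) : E idfun -> closed_span E idfun.
Proof.
move=> Eid; split=> [|e e0]; first exact: bounded_id.
exists idfun; first by move=> P [_ EP]; exact: EP.
by move=> x; rewrite subrr [leLHS]normr0 mulr_ge0// ltW.
Qed.

Lemma scalar_nondegenerate : Defs.nondegenerate scalar_operators.
Proof. by split; apply: id_span; exists idfun, idfun. Qed.

Lemma scalar_product (S T : set (H -> H)) :
  concrete_operator_system S -> S `<=` T ->
  product_set (product_set (adjoint_set scalar_operators) S) scalar_operators `<=` T /\
  product_set (product_set scalar_operators S) (adjoint_set scalar_operators) `<=` T.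
Proof.
move=> [bS [S0 Slin] _ _] ST.
have SZ (a : R[i]) A : S A -> S (a *: A).
  by move=> SA; rewrite -[_ *: _]addr0; exact: Slin.
have key a b A : S A -> T ((a *: idfun) \o A \o (b *: idfun)).
  move=> SA; apply: ST; rewrite (_ : (_ \o _) \o _ = (a * b) *: A); first exact: SZ.
  by apply/funext => x /=; rewrite !fctE (linZ (bounded_lin (bS _ SA))) scalerA.
split=> _ [_ [B [[B' [A [+ SA ->]]]]] + ->].
  by move=> /scalar_adjoint[a ->] [b ->]; exact: key.
by move=> [a ->] /scalar_adjoint[b ->]; exact: key.
Qed.

End ScalarTRO.

Lemma isomorphic_Delta_equivalent (R : realType) (X Y : topologicalType)
  (S : set (Cfun R X)) (T : set (Cfun R Y)) :
  compact [set: X] -> compact [set: Y] ->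
  function_system S -> function_system T ->
  unital_complete_order_isomorphic (sup_closure S) (sup_closure T) ->
  Delta_equivalent S T.
Proof.
move=> cptX cptY fsS fsT [theta htheta imtheta].
have fsT' := sup_closure_function_system fsT.
have psi_emb := mulop_embedding cptY (fun f (Tf : sup_closure T f) => Tf.1)
  (sup_closure_linear fsT).
have phi_emb := embedding_comp htheta psi_emb.
pose phi : Cfun R X -> Bop (@l2_hilbert R Y) := mulop \o theta.
pose psi : Cfun R Y -> Bop (@l2_hilbert R Y) := mulop.
have phiS := embedding_sub (@sub_sup_closure _ _ _ fsS) phi_emb.
have psiT := embedding_sub (@sub_sup_closure _ _ _ fsT) psi_emb.
exists l2_hilbert, l2_hilbert, phi, psi; split=> //.
have cS := embedding_concrete cptX fsS phiS.
have cT := embedding_concrete cptY fsT psiT.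
split; [exact: cS|exact: cT|].
exists scalar_operators.
split; [exact: scalar_TRO|exact: scalar_nondegenerate| |].
  apply: (scalar_product cT _).1 => _ [g Tg <-].
  have : sup_closure T g by exact: sub_sup_closure.
  (* Surjectivity of [theta] brings [g] back to the closure of [S], which [phi] maps into the norm
     closure of the image of [S]. *)
  rewrite -imtheta => -[f Sf <-].
  exact: (embedding_sup_closure fsS cptX phi_emb Sf).
apply: (scalar_product cS _).2 => _ [f Sf <-].
apply: (embedding_sup_closure fsT cptY psi_emb).
by rewrite -imtheta; exists f => //; exact: sub_sup_closure.
Qed.

Theorem theorem6p1 (R : realType) (X Y : topologicalType)
  (cptX : compact [set: X]) (hausX : hausdorff_space X)
  (cptY : compact [set: Y]) (hausY : hausdorff_space Y)
  (S : set (Cfun R X)) (T : set (Cfun R Y))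
  (fsS : function_system S) (fsT : function_system T) :
  Delta_equivalent S T <->
  unital_complete_order_isomorphic (sup_closure S) (sup_closure T).
Proof.
split; first exact: Delta_equivalent_isomorphic.
exact: isomorphic_Delta_equivalent.
Qed.
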